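(* Let $G=(V,E)$ be an undirected graph and let $u,v\in V$ with $u\neq v$. Let $\widehat{\mathcal T}$ be a collection of pairwise edge-disjoint odd $(\{u,v\},\{u,v\})$-trails in $G$. If $\lambda(u,v)\ge 2\,|\widehat{\mathcal T}|$, then one can obtain in polynomial time $|\widehat{\mathcal T}|$ pairwise edge-disjoint odd $(u,v)$-trails in $G$.
   Context: Graphs may have parallel edges. A $(p,q)$-walk is a sequence $(x_0,e_1,x_1,\dots,e_r,x_r)$ of vertices and edges with $x_0=p$, $x_r=q$, and each $e_i$ an edge with ends $x_{i-1},x_i$. A $(p,q)$-trail is a $(p,q)$-walk whose edges are pairwise distinct (vertices may repeat, $p=q$ allowed). For vertex sets $A,B$, an $(A,B)$-trail is a $(p,q)$-trail for some $p\in A$, $q\in B$. A trail is odd if it has an odd number of edges. $\lambda(u,v)$ denotes the minimum number of edges in a $(u,v)$-cut of $G$, equivalently the maximum number of pairwise edge-disjoint $(u,v)$-paths. *)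

(* Defs.v *)
From mathcomp Require Import all_boot.

Set Implicit Arguments.
Unset Strict Implicit.
Unset Printing Implicit Defensive.

(* The order of the two components of [ends e] is irrelevant (see [joins]).
   Parallel edges and loops are allowed. *)
Record mgraph := MGraph {
  vertex : finType;
  edge : finType;
  ends : edge -> vertex * vertex
}.

Definition joins (G : mgraph) (e : edge G) (x y : vertex G) : bool :=
  (ends e == (x, y)) || (ends e == (y, x)).

(* The alternating sequence (x_0, e_1, x_1, ..., e_r, x_r) is stored as
   (x_0, [:: (e_1, x_1); ...; (e_r, x_r)]). *)
Definition walk (G : mgraph) : Type :=
  (vertex G * seq (edge G * vertex G))%type.

Fixpoint steps_ok (G : mgraph) (x : vertex G)
    (s : seq (edge G * vertex G)) : bool :=
  if s is (e, y) :: s' then joins e x y && steps_ok y s' else true.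

Definition walk_edges (G : mgraph) (w : walk G) : seq (edge G) := unzip1 w.2.

Definition walk_length (G : mgraph) (w : walk G) : nat := size (walk_edges w).

Definition is_walk (G : mgraph) (p q : vertex G) (w : walk G) : bool :=
  [&& w.1 == p, last w.1 (unzip2 w.2) == q & steps_ok w.1 w.2].

Definition is_trail (G : mgraph) (p q : vertex G) (w : walk G) : bool :=
  is_walk p q w && uniq (walk_edges w).

Definition is_set_trail (G : mgraph) (A B : {set vertex G}) (w : walk G)
    : bool :=
  [exists p in A, exists q in B, is_trail p q w].

Definition edge_disjoint (G : mgraph) (w1 w2 : walk G) : bool :=
  [disjoint walk_edges w1 & walk_edges w2].

Definition cut_edges (G : mgraph) (S : {set vertex G}) : {set edge G} :=
  [set e | ((ends e).1 \in S) != ((ends e).2 \in S)].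

(* The seed [set u] of the arg min separates u from v exactly when u != v, so
   [lambda u v] is meaningful only for distinct u and v. *)
Definition lambda (G : mgraph) (u v : vertex G) : nat :=
  #|cut_edges [arg min_(S < [set u] | (u \in S) && (v \notin S))
                 #|cut_edges S| ]|.

(* The WHILE language over binary trees (N. D. Jones, Computability and
   Complexity from a Programming Perspective), in variable-free form: a program
   transforms one tree, and several values are kept together with [Pair].
   Every elementary operation is charged the size of the tree it reads or
   copies, not a unit, so that no exponentially large tree can be built cheaply
   by sharing; hence polynomial time here is polynomial time on a Turing
   machine. *)

Inductive tree := Leaf | Node of tree & tree.

Fixpoint tree_size (x : tree) : nat :=
  if x is Node l r then (tree_size l + tree_size r).+1 else 1.

Inductive prog :=
  | Id
  | Nil
  | Hd
  | Tl
  | Pair of prog & prog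
  | Seq of prog & prog
  | Cond of prog & prog & prog
  | While of prog & prog.

Definition hd (x : tree) : tree := if x is Node l _ then l else Leaf.
Definition tl (x : tree) : tree := if x is Node _ r then r else Leaf.

(* [run P x y t]: on input x, the program P halts with output y in time t.
   In tests, [Leaf] is false and every other tree is true. *)
Inductive run : prog -> tree -> tree -> nat -> Prop :=
  | RunId x : run Id x x (tree_size x)
  | RunNil x : run Nil x Leaf (tree_size x)
  | RunHd x : run Hd x (hd x) (tree_size x)
  | RunTl x : run Tl x (tl x) (tree_size x)
  | RunPair P Q x y z s t :
      run P x y s -> run Q x z t ->
      run (Pair P Q) x (Node y z) (s + t + tree_size x)
  | RunSeq P Q x y z s t :
      run P x y s -> run Q y z t ->
      run (Seq P Q) x z (s + t + tree_size x)
  | RunCondTrue B P Q x l r y s t :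
      run B x (Node l r) s -> run P x y t ->
      run (Cond B P Q) x y (s + t + tree_size x)
  | RunCondFalse B P Q x y s t :
      run B x Leaf s -> run Q x y t ->
      run (Cond B P Q) x y (s + t + tree_size x)
  | RunWhileStop B P x s :
      run B x Leaf s ->
      run (While B P) x x (s + tree_size x)
  | RunWhileStep B P x l r y z s t t' :
      run B x (Node l r) s -> run P x y t -> run (While B P) y z t' ->
      run (While B P) x z (s + t + t' + tree_size x).

(* Vertices and edges are named by their ranks, and edge number i is the i-th
   item of the edge list of the encoded graph. Ranks are written in unary; as
   the input also lists all vertices (through their number) and all edges, this
   changes its size only polynomially. *)

Definition enc_nat (n : nat) : tree := iter n (Node Leaf) Leaf.

Definition enc_seq (T : Type) (enc : T -> tree) (s : seq T) : tree :=
  foldr (fun x => Node (enc x)) Leaf s.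

Definition enc_elt (T : finType) (x : T) : tree := enc_nat (enum_rank x).

Definition enc_pair (T1 T2 : finType) (x : T1 * T2) : tree :=
  Node (enc_elt x.1) (enc_elt x.2).

Definition enc_graph (G : mgraph) : tree :=
  Node (enc_nat #|vertex G|)
       (enc_seq (fun e => enc_pair (ends e)) (enum (edge G))).

Definition enc_walk (G : mgraph) (w : walk G) : tree :=
  Node (enc_elt w.1) (enc_seq (fun s => enc_pair s) w.2).

Definition enc_walks (G : mgraph) (ws : seq (walk G)) : tree :=
  enc_seq (fun w => enc_walk w) ws.

Definition enc_instance (G : mgraph) (u v : vertex G) (ws : seq (walk G))
    : tree :=
  Node (enc_graph G) (Node (enc_pair (u, v)) (enc_walks ws)).

(* Main.v *)
(** Let P be a family of 2k edge-disjoint simple paths between u and v, found by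
    flow augmentation. Follow a path from one of its ends to the first edge used
    by a trail T: there one may continue along T in either direction, and since
    T is odd, exactly one of the two resulting trails is odd. Replace T by it as
    long as this lowers the number of breaks, the turns of the trails that do
    not follow a path. When no such step is left, each path met by two or more
    trails carries a trail end at both of its extremities, and each path met by
    exactly one trail carries an end of that trail. As there are 2k trail ends
    and 2k paths, the paths met by no trail are at least as numerous as the
    trails with no path of their own. So every closed trail T can be given a
    path of its own, meeting no other trail; following it from the terminal that
    T misses up to T, and then T in the right direction, gives an odd trail
    between u and v.

    Programs are assembled from left folds whose state grows, at each step, by
    an amount polynomial in the other data. *)

Require Import Defs.
From mathcomp Require Import all_boot.
From mathcomp Require Import zify.

Set Implicit Arguments.
Unset Strict Implicit.
Unset Printing Implicit Defensive.

(** Why a stuck family has its ends where the count needs them: let [d] be the first dart of a path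
    whose edge lies on a trail, and orient that trail so that it traverses [d] too. Arriving along
    the path instead of along the trail removes the break just before [d] and creates none. If this
    splice is the odd one, a stuck trail must therefore start with [d], at the extremity of the
    path. If the odd splice is the one that turns back, it creates at most one break and removes the
    one before [d] and all those after it; a stuck trail then follows the path from [d] to its far
    extremity, so that no other trail meets the path. In both cases a trail end and a path extremity
    are the same dart. Extremities of disjoint simple paths are distinct darts, so every trail end
    is charged at most once. With a, f, s paths met by no, one, several trails, and g trails owning
    a path: f + 2s <= 2k = a + f + s and f <= 2g, whence a >= k - g. *)

(** * Encodings of data as trees and their sizes *)

Class encodable (A : Type) := enc : A -> tree.

#[global] Instance encodable_nat : encodable nat := enc_nat.
#[global] Instance encodable_unit : encodable unit := fun=> Leaf.
#[global] Instance encodable_bool : encodable bool :=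
  fun b => if b then Node Leaf Leaf else Leaf.
#[global] Instance encodable_prod A B `{encodable A} `{encodable B} :
  encodable (A * B) := fun p => Node (enc p.1) (enc p.2).
#[global] Instance encodable_seq A `{encodable A} : encodable (seq A) :=
  enc_seq enc.

Definition esize A `{encodable A} (a : A) : nat := tree_size (enc a).

Lemma tree_size_gt0 x : 0 < tree_size x.
Proof. by case: x. Qed.

Lemma esize_gt0 A `{encodable A} (a : A) : 0 < esize a.
Proof. exact: tree_size_gt0. Qed.

Lemma esize_pair A B `{encodable A} `{encodable B} (p : A * B) :
  esize p = (esize p.1 + esize p.2).+1.
Proof. by []. Qed.

Lemma esize_cons A `{encodable A} (a : A) s :
  esize (a :: s) = (esize a + esize s).+1.
Proof. by []. Qed.

Lemma size_esize A `{encodable A} (s : seq A) : size s < esize s.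
Proof. by elim: s => // a s IH; rewrite esize_cons /=; lia. Qed.

Lemma esize_cat A `{encodable A} (s t : seq A) :
  (esize (s ++ t)).+1 = esize s + esize t.
Proof. by elim: s => //= a s IH; rewrite !esize_cons; lia. Qed.

Lemma esize_bool (b : bool) : esize b <= 3.
Proof. by case: b. Qed.

Lemma esize_nat n : esize n = n.*2.+1.
Proof.
by rewrite /esize /enc /encodable_nat; elim: n => //= n ->; rewrite add1n doubleS.
Qed.

(** Every operation is charged the tree it reads, so a running time also bounds the output; this is
    what keeps the second program of a composition polynomial in the original input. *)
Lemma run_size P x y t : run P x y t -> tree_size y <= t.
Proof.
elim=> {P x y t} //=; try (by move=> *; lia); try (by case=> //= *; lia).
by move=> P Q x y z s t _ ? _ ?; have := tree_size_gt0 x; lia.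
Qed.

(** * Polynomial bounds and polynomial-time functions *)

(** One monomial is enough as a normal form: encodings have positive size, so exponents can be
    raised when bounds are added. *)
Definition pbound A `{encodable A} (q : A -> nat) :=
  exists c d, forall a, q a <= c * esize a ^ d.

Section Pbound.
Variables (A : Type) (eA : encodable A).
Implicit Types q r : A -> nat.

Lemma pbound_le r q : pbound r -> (forall a, q a <= r a) -> pbound q.
Proof.
by move=> [c [d h]] le; exists c, d => a; apply: leq_trans (le a) (h a).
Qed.

Lemma pbound_const n : pbound (fun _ : A => n).
Proof. by exists n, 0 => a; rewrite muln1. Qed.

Lemma pbound_esize : pbound (@esize A eA).
Proof. by exists 1, 1 => a; rewrite mul1n. Qed.

Lemma pboundD q r : pbound q -> pbound r -> pbound (fun a => q a + r a).
Proof.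
move=> [c [d hq]] [c' [d' hr]]; exists (c + c'), (d + d') => a.
have s0 := esize_gt0 a.
rewrite mulnDl leq_add //.
  by rewrite (leq_trans (hq a)) // leq_mul2l leq_pexp2l ?orbT // leq_addr.
by rewrite (leq_trans (hr a)) // leq_mul2l leq_pexp2l ?orbT // leq_addl.
Qed.

Lemma pboundM q r : pbound q -> pbound r -> pbound (fun a => q a * r a).
Proof.
move=> [c [d hq]] [c' [d' hr]]; exists (c * c'), (d + d') => a.
by rewrite expnD mulnACA leq_mul.
Qed.

Lemma pboundX q n : pbound q -> pbound (fun a => q a ^ n).
Proof.
move=> [c [d hq]]; exists (c ^ n), (d * n) => a.
by rewrite expnM -expnMn; case: n => // n; rewrite leq_exp2r.
Qed.

End Pbound.

Definition polytime A B `{encodable A} `{encodable B} (f : A -> B) :=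
  exists P (q : A -> nat), pbound q /\
    forall a, exists2 t, run P (enc a) (enc (f a)) t & t <= q a.

Lemma polytime_size A B (eA : encodable A) (eB : encodable B) (f : A -> B) :
  polytime f -> pbound (fun a => esize (f a)).
Proof.
move=> [P [q [pq h]]]; apply: pbound_le pq _ => a.
by have [t /run_size r lt] := h a; apply: leq_trans r lt.
Qed.

Lemma pbound_comp A B (eA : encodable A) (eB : encodable B)
    (f : A -> B) (q : B -> nat) :
  pbound (fun a => esize (f a)) -> pbound q -> pbound (fun a => q (f a)).
Proof.
move=> pf [c [d h]]; apply: (@pbound_le _ _ (fun a => c * esize (f a) ^ d)) => //.
by apply: pboundM; [apply: pbound_const | apply: pboundX].
Qed.

Section Closure.
Variables (X A B C : Type).
Variables (eX : encodable X) (eA : encodable A) (eB : encodable B).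
Variables (eC : encodable C).

Lemma pt_eq (f g : X -> A) : f =1 g -> polytime g -> polytime f.
Proof.
move=> fg [P [q [pq h]]]; exists P, q; split=> // x.
by have [t] := h x; exists t; rewrite ?fg.
Qed.

Lemma pt_id : polytime (fun x : X => x).
Proof.
exists Id, (@esize X eX); split; first exact: pbound_esize.
by move=> x; exists (esize x) => //; apply: RunId.
Qed.

Lemma pt_comp (g : A -> B) (f : X -> A) :
  polytime g -> polytime f -> polytime (fun x => g (f x)).
Proof.
move=> [Q [r [pr hr]]] pf; have [P [q [pq hq]]] := pf.
exists (Seq P Q), (fun x => q x + r (f x) + esize x); split.
  apply: pboundD; last exact: pbound_esize.
  by apply: pboundD => //; apply: (pbound_comp (polytime_size pf)).
move=> x; have [s rs ls] := hq x; have [t rt lt] := hr (f x).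
exists (s + t + esize x); first exact: RunSeq rs rt.
by rewrite leq_add2r leq_add.
Qed.

Lemma pt_pair (f : X -> A) (g : X -> B) :
  polytime f -> polytime g -> polytime (fun x => (f x, g x)).
Proof.
move=> [P [q [pq hq]]] [Q [r [pr hr]]].
exists (Pair P Q), (fun x => q x + r x + esize x); split.
  by do 2?apply: pboundD => //; apply: pbound_esize.
move=> x; have [s rs ls] := hq x; have [t rt lt] := hr x.
exists (s + t + esize x); first exact: RunPair rs rt.
by rewrite leq_add2r leq_add.
Qed.

Lemma pt_if (b : X -> bool) (f g : X -> A) :
  polytime b -> polytime f -> polytime g ->
  polytime (fun x => if b x then f x else g x).
Proof.
move=> [B' [p [pp hp]]] [P [q [pq hq]]] [Q [r [pr hr]]].
exists (Cond B' P Q), (fun x => p x + (q x + r x) + esize x); split.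
  by do 3?apply: pboundD => //; apply: pbound_esize.
move=> x; have [a ra la] := hp x; have [s rs ls] := hq x.
have [t rt lt] := hr x; move: ra; case: (b x) => ra.
  exists (a + s + esize x); first exact: RunCondTrue ra rs.
  by rewrite leq_add2r leq_add // (leq_trans ls) // leq_addr.
exists (a + t + esize x); first exact: RunCondFalse ra rt.
by rewrite leq_add2r leq_add // (leq_trans lt) // leq_addl.
Qed.

(** Values of different types may share a tree: a list cell is coded as a pair, a successor as the
    unit value paired with its predecessor, a number as a list of units. Passing between such types
    needs no computation. *)
Lemma pt_same_enc (f : X -> A) (g : X -> B) :
  (forall x, enc (f x) = enc (g x)) -> polytime g -> polytime f.
Proof.
move=> fg [P [q [pq h]]]; exists P, q; split=> // x.
by have [t] := h x; exists t; rewrite ?fg.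
Qed.

Lemma pt_const (a : A) : polytime (fun _ : X => a).
Proof.
have treeP (y : tree) : exists P (q : X -> nat), pbound q /\
    forall x, exists2 t, run P (enc x) y t & t <= q x.
  elim: y => [|l [P [q [pq hq]]] r [Q [s [ps hs]]]].
    exists Defs.Nil, (@esize X eX); split; first exact: pbound_esize.
    by move=> x; exists (esize x) => //; apply: RunNil.
  exists (Pair P Q), (fun x => q x + s x + esize x); split.
    by do 2?apply: pboundD => //; apply: pbound_esize.
  move=> x; have [t rt lt] := hq x; have [t' rt' lt'] := hs x.
  exists (t + t' + esize x); first exact: RunPair rt rt'.
  by rewrite leq_add2r leq_add.
exact: treeP (enc a).
Qed.

End Closure.

Section HeadTail.
Variables (X A B : Type).
Variables (eX : encodable X) (eA : encodable A) (eB : encodable B).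

Lemma pt_hd (f : X -> A) (g : X -> B) :
  (forall x, enc (g x) = Defs.hd (enc (f x))) -> polytime f -> polytime g.
Proof.
move=> fg pf; have [P [q [pq hq]]] := pf.
exists (Seq P Hd), (fun x => q x + esize (f x) + esize x); split.
  apply: pboundD; last exact: pbound_esize.
  by apply: pboundD => //; apply: polytime_size.
move=> x; have [t rt lt] := hq x; rewrite fg.
exists (t + esize (f x) + esize x); last by rewrite !leq_add2r.
by apply: RunSeq rt _; apply: RunHd.
Qed.

Lemma pt_tl (f : X -> A) (g : X -> B) :
  (forall x, enc (g x) = Defs.tl (enc (f x))) -> polytime f -> polytime g.
Proof.
move=> fg pf; have [P [q [pq hq]]] := pf.
exists (Seq P Tl), (fun x => q x + esize (f x) + esize x); split.
  apply: pboundD; last exact: pbound_esize.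
  by apply: pboundD => //; apply: polytime_size.
move=> x; have [t rt lt] := hq x; rewrite fg.
exists (t + esize (f x) + esize x); last by rewrite !leq_add2r.
by apply: RunSeq rt _; apply: RunTl.
Qed.

End HeadTail.

Section Projections.
Variables (X A B : Type).
Variables (eX : encodable X) (eA : encodable A) (eB : encodable B).

Lemma pt_fst (f : X -> A * B) : polytime f -> polytime (fun x => (f x).1).
Proof. exact: pt_hd. Qed.

Lemma pt_snd (f : X -> A * B) : polytime f -> polytime (fun x => (f x).2).
Proof. exact: pt_tl. Qed.

Lemma pt_cons (f : X -> A) (g : X -> seq A) :
  polytime f -> polytime g -> polytime (fun x => f x :: g x).
Proof.
move=> pf pg.
by apply: (@pt_same_enc _ _ _ _ _ _ _ (fun x => (f x, g x))) => //; apply: pt_pair.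
Qed.

Lemma pt_behead (f : X -> seq A) : polytime f -> polytime (fun x => behead (f x)).
Proof. by apply: pt_tl => x; case: (f x). Qed.

(** Emptiness is what [Cond] tests natively, since [Leaf] codes the empty list only; comparison of
    numbers is later reduced to it. *)
Lemma pt_nilp (f : X -> seq A) : polytime f -> polytime (fun x => nilp (f x)).
Proof.
move=> [P [q [pq hq]]]; have pf : polytime f by exists P, q.
exists (Cond P Defs.Nil (Pair Defs.Nil Defs.Nil)).
exists (fun x => q x + (esize x * 3) + esize x).
split.
  apply: pboundD; last exact: pbound_esize.
  apply: pboundD => //; apply: pboundM; first exact: pbound_esize.
  exact: pbound_const.
move=> x; have [t rt lt] := hq x; move: rt; case E: (f x) => [|a s] rt.
  exists (t + (esize x + esize x + esize x) + esize x).
    by apply: RunCondFalse rt _; apply: RunPair; apply: RunNil.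
  by rewrite leq_add2r leq_add //; lia.
exists (t + esize x + esize x); first by apply: RunCondTrue rt _; apply: RunNil.
by rewrite leq_add2r leq_add //; lia.
Qed.

Lemma pt_head (a : X -> A) (f : X -> seq A) :
  polytime a -> polytime f -> polytime (fun x => head (a x) (f x)).
Proof.
move=> pa pf.
have pe : polytime (fun x => if nilp (f x) then [:: a x] else f x).
  apply: pt_if => //; first exact: pt_nilp.
  by apply: pt_cons => //; apply: pt_const.
by apply: pt_hd pe => x; case: (f x).
Qed.

End Projections.

(** * Loops as folds, and list operations built from them *)

Section Fold.
Variables (C S A : Type).
Variables (eC : encodable C) (eS : encodable S) (eA : encodable A).
Variable f : C -> S -> A -> S.
Hypothesis pf : polytime (fun x : C * (S * A) => f x.1 x.2.1 x.2.2).

(** The loop carries the context, the state and the remaining list. Bounding every intermediate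
    state in terms of the initial data gives one bound [M] for the cost of each round. *)
Lemma pt_foldl_bounded (B : C * (S * seq A) -> nat) :
    pbound B ->
    (forall c s l l', esize (foldl (f c) s l) <= B (c, (s, l ++ l'))) ->
  polytime (fun x : C * (S * seq A) => foldl (f x.1) x.2.1 x.2.2).
Proof.
move=> pB hB.
pose body (x : C * (S * (A * seq A))) :=
  (x.1, (f x.1 x.2.1 x.2.2.1, x.2.2.2)).
have pbody : polytime body.
  have p0 := @pt_id (C * (S * (A * seq A)))%type _.
  apply: pt_pair; first exact: pt_fst.
  apply: pt_pair; last by do 3 apply: pt_snd.
  apply: (pt_comp (f := fun x => (x.1, (x.2.1, x.2.2.1))) pf).
  apply: pt_pair; first exact: pt_fst.
  apply: pt_pair; first by apply: pt_fst; apply: pt_snd.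
  by apply: pt_fst; do 2 apply: pt_snd.
have ptest : polytime (fun x : C * (S * seq A) => x.2.2).
  by do 2 apply: pt_snd; apply: pt_id.
have [P [q [[c1 [d1 hq]] hP]]] := pbody.
have [T [r [[c2 [d2 hr]] hT]]] := ptest.
pose (N := fun x : C * (S * seq A) => esize x + B x).
pose (M := fun x : C * (S * seq A) => c1 * N x ^ d1 + c2 * N x ^ d2 + N x).
have pN : pbound N by apply: pboundD => //; apply: pbound_esize.
have pM : pbound M.
  by do !apply: pboundD => //; apply: pboundM; by [apply: pbound_const|apply: pboundX].
have hBx x l1 l2 : l1 ++ l2 = x.2.2 -> esize (foldl (f x.1) x.2.1 l1) <= B x.
  by case: x => c [s l] /= <-; apply: hB.
have hrun x l1 l2 : l1 ++ l2 = x.2.2 -> exists2 t,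
    run (While T P) (enc (x.1, (foldl (f x.1) x.2.1 l1, l2)))
      (enc (x.1, (foldl (f x.1) x.2.1 (l1 ++ l2), [::] : seq A))) t &
    t <= (size l2).+1 * M x.
  elim: l2 l1 => [|a l2 IH] l1 El.
    set y := (x.1, (foldl (f x.1) x.2.1 l1, [::] : seq A)).
    have [t rt lt] := hT y; rewrite cats0.
    exists (t + esize y); first exact: RunWhileStop rt.
    have Ny : esize y <= N x.
      have -> : esize y =
          (esize x.1 + (esize (foldl (f x.1) x.2.1 l1) + 1).+1).+1 by [].
      have := hBx _ _ _ El; pose proof (esize_gt0 x.2.2).
      by rewrite /N !esize_pair; lia.
    rewrite mul1n /M; apply: leq_add => //.
    rewrite (leq_trans lt) // (leq_trans (hr y)) //.
    apply: leq_trans (leq_addl _ _); rewrite leq_mul2l; apply/orP; right.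
    by case: (d2) => // d; rewrite leq_exp2r.
  set y := (x.1, (foldl (f x.1) x.2.1 l1, a :: l2)).
  (* [a :: l2] and [(a, l2)] have the same encoding, so the body can take the list apart as a pair,
     without a default head. *)
  pose y' : C * (S * (A * seq A)) := (x.1, (foldl (f x.1) x.2.1 l1, (a, l2))).
  have [t rt lt] := hT y; have [t' rt' lt'] := hP y'.
  have [] := IH (rcons l1 a); first by rewrite cat_rcons.
  rewrite foldl_rcons cat_rcons => t'' rt'' lt''.
  exists (t + t' + t'' + esize y); first exact: RunWhileStep rt rt' rt''.
  have Ny : esize y <= N x.
    have -> : esize y =
        (esize x.1 + (esize (foldl (f x.1) x.2.1 l1) + esize (a :: l2)).+1).+1.
      by [].
    have := hBx _ _ _ El; have : esize (a :: l2) <= esize x.2.2.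
      rewrite -El; elim: (l1) => //= b l' hl'.
      by rewrite [esize (b :: _)]esize_cons; lia.
    by rewrite /N !esize_pair; lia.
  have Ny' : esize y' <= N x by [].
  have h : t + t' + esize y <= M x; last by rewrite addnAC mulSn leq_add.
  rewrite /M; apply: leq_add => //; rewrite addnC; apply: leq_add.
    rewrite (leq_trans lt') // (leq_trans (hq y')) //.
    rewrite leq_mul2l; apply/orP; right.
    by case: (d1) => // d; rewrite leq_exp2r.
  rewrite (leq_trans lt) // (leq_trans (hr y)) //.
  rewrite leq_mul2l; apply/orP; right.
  by case: (d2) => // d; rewrite leq_exp2r.
have pw : polytime (fun x : C * (S * seq A) =>
    (x.1, (foldl (f x.1) x.2.1 x.2.2, [::] : seq A))).
  exists (While T P), (fun x => esize x * M x); split.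
    by apply: pboundM => //; apply: pbound_esize.
  move=> x; have [t rt lt] := hrun x [::] x.2.2 erefl.
  exists t.
    by move: rt; case: (x) => c [s l].
  rewrite (leq_trans lt) // leq_mul2r; apply/orP; right.
  rewrite !esize_pair; pose proof (size_esize x.2.2); lia.
by apply: pt_eq (pt_fst (pt_snd pw)).
Qed.

(* Only additive growth of the state survives iteration: a bound multiplying
   the size at each step would be exponential in the end. *)
Lemma pt_foldl_additive (g : C -> A -> nat) :
    pbound (fun x : C * A => g x.1 x.2) ->
    (forall c s a, esize (f c s a) <= esize s + g c a) ->
  polytime (fun x : C * (S * seq A) => foldl (f x.1) x.2.1 x.2.2).
Proof.
move=> [k [d hg]] hf.
pose (B := fun x : C * (S * seq A) =>
  esize x.2.1 + size x.2.2 * (k * esize x ^ d)).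
apply: (pt_foldl_bounded (B := B)).
  apply: (@pbound_le _ _ (fun x => esize x + esize x * (k * esize x ^ d))).
    have pe := @pbound_esize (C * (S * seq A))%type _.
    apply: pboundD => //; apply: pboundM => //.
    by apply: pboundM; [apply: pbound_const | apply: pboundX].
  move=> x; apply: leq_add; first by rewrite !esize_pair; lia.
  rewrite leq_mul2r !esize_pair; pose proof (size_esize x.2.2); lia.
move=> c s l l'; rewrite /B /= size_cat.
set K := k * _.
have h : forall m s', esize m <= esize (l ++ l') ->
    esize (foldl (f c) s' m) <= esize s' + size m * K; last first.
  apply: leq_trans (h l s _) _.
    by elim: (l) => [|b m IH]; rewrite ?esize_gt0 //= !esize_cons; lia.
  by rewrite leq_add2l leq_mul2r leq_addr orbT.
elim=> [|a m IH] s' /=; first by rewrite addn0.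
rewrite esize_cons => hm; apply: leq_trans (IH _ _) _; first by lia.
rewrite mulSn addnA leq_add2r (leq_trans (hf _ _ _)) // leq_add2l.
apply: leq_trans (hg (c, a)) _; rewrite leq_mul2l; apply/orP; right.
case: (d) => // e; rewrite leq_exp2r // !esize_pair /=; lia.
Qed.

End Fold.

Section ContextFold.
Variables (X S A : Type).
Variables (eX : encodable X) (eS : encodable S) (eA : encodable A).
Variables (f : X -> S -> A -> S) (s : X -> S) (l : X -> seq A).

Lemma pt_foldl (g : X -> A -> nat) :
    polytime (fun x : X * (S * A) => f x.1 x.2.1 x.2.2) ->
    polytime s -> polytime l -> pbound (fun x : X * A => g x.1 x.2) ->
    (forall c s a, esize (f c s a) <= esize s + g c a) ->
  polytime (fun x => foldl (f x) (s x) (l x)).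
Proof.
move=> pf ps pl pg h.
apply: (pt_comp (pt_foldl_additive pf pg h) (f := fun x => (x, (s x, l x)))).
by do 2?apply: pt_pair => //; apply: pt_id.
Qed.

End ContextFold.

Ltac pt_base := first
  [ assumption | simple eapply pt_id | simple eapply pt_const
  | simple eapply pt_fst | simple eapply pt_snd | simple eapply pt_pair
  | simple eapply pt_cons | simple eapply pt_behead | simple eapply pt_head
  | simple eapply pt_nilp | simple eapply pt_if ].

Ltac pt := repeat (cbv beta; pt_base).

Lemma pt_comp2 X A B C (eX : encodable X) (eA : encodable A)
    (eB : encodable B) (eC : encodable C) (f : A -> B -> C)
    (pf : polytime (fun p : A * B => f p.1 p.2)) (a : X -> A) (b : X -> B) :
  polytime a -> polytime b -> polytime (fun x => f (a x) (b x)).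
Proof. by move=> pa pb; apply: (pt_comp pf (pt_pair pa pb)). Qed.

Section Bool.
Variables (X : Type) (eX : encodable X) (a b : X -> bool).
Hypotheses (pa : polytime a) (pb : polytime b).

Lemma pt_negb : polytime (fun x => ~~ a x).
Proof. by apply: (@pt_eq _ _ _ _ _ (fun x => if a x then false else true)); pt. Qed.

Lemma pt_andb : polytime (fun x => a x && b x).
Proof. by apply: (@pt_eq _ _ _ _ _ (fun x => if a x then b x else false)); pt. Qed.

Lemma pt_orb : polytime (fun x => a x || b x).
Proof. by apply: (@pt_eq _ _ _ _ _ (fun x => if a x then true else b x)); pt. Qed.

End Bool.

Lemma pbound_item X A (eX : encodable X) (eA : encodable A) n :
  pbound (fun x : X * A => esize x.2 + n).
Proof.
apply: (@pbound_le _ _ (fun x => esize x + n)).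
  by apply: pboundD; [apply: pbound_esize | apply: pbound_const].
by move=> x; rewrite leq_add2r esize_pair; lia.
Qed.

Section Rev.
Variables (X A : Type) (eX : encodable X) (eA : encodable A).

Lemma pt_catrev (s t : X -> seq A) :
  polytime s -> polytime t -> polytime (fun x => catrev (s x) (t x)).
Proof.
move=> ps pt'.
apply: (@pt_eq _ _ _ _ _ (fun x => foldl (fun acc a => a :: acc) (t x) (s x))).
  by move=> x; elim: (s x) (t x) => //= a l IH u; rewrite IH.
apply: (pt_foldl (g := fun _ a => @esize A eA a + 1)); pt; first exact: pbound_item.
by move=> c t' a; rewrite esize_cons; lia.
Qed.

Lemma pt_rev (s : X -> seq A) : polytime s -> polytime (fun x => rev (s x)).
Proof. by move=> ps; apply: pt_catrev; pt. Qed.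

End Rev.

Ltac pt_base ::= first
  [ assumption | simple eapply pt_id | simple eapply pt_const
  | simple eapply pt_fst | simple eapply pt_snd | simple eapply pt_pair
  | simple eapply pt_cons | simple eapply pt_behead | simple eapply pt_head
  | simple eapply pt_nilp | simple eapply pt_if | simple eapply pt_negb
  | simple eapply pt_andb | simple eapply pt_orb | simple eapply pt_catrev
  | simple eapply pt_rev ].

Section Foldr.
Variables (X S A : Type).
Variables (eX : encodable X) (eS : encodable S) (eA : encodable A).

Lemma pt_foldr (f : X -> A -> S -> S) (s : X -> S) (l : X -> seq A)
    (g : X -> A -> nat) :
    polytime (fun x : X * (S * A) => f x.1 x.2.2 x.2.1) ->
    polytime s -> polytime l -> pbound (fun x : X * A => g x.1 x.2) ->
    (forall c s a, esize (f c a s) <= esize s + g c a) ->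
  polytime (fun x => foldr (f x) (s x) (l x)).
Proof.
move=> pf ps pl pg h.
apply: (@pt_eq _ _ _ _ _ (fun x => foldl (fun z a => f x a z) (s x) (rev (l x)))).
  by move=> x; rewrite foldl_rev.
by apply: pt_foldl pg h; pt.
Qed.

End Foldr.

Section SeqOps.
Variables (X A B : Type).
Variables (eX : encodable X) (eA : encodable A) (eB : encodable B).

Lemma pt_map (f : X -> A -> B) (s : X -> seq A) :
    polytime (fun p : X * A => f p.1 p.2) -> polytime s ->
  polytime (fun x => map (f x) (s x)).
Proof.
move=> pf ps.
apply: (@pt_foldr _ _ _ _ _ _ (fun x a l => f x a :: l) (fun=> [::]) s
  (fun x a => @esize B eB (f x a) + 1)); pt.
- by apply: (pt_comp2 pf); pt.
- apply: pboundD; last exact: pbound_const.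
  exact: polytime_size pf.
by move=> c l a; rewrite esize_cons; lia.
Qed.

Lemma pt_filter (f : X -> A -> bool) (s : X -> seq A) :
    polytime (fun p : X * A => f p.1 p.2) -> polytime s ->
  polytime (fun x => filter (f x) (s x)).
Proof.
move=> pf ps.
apply: (@pt_foldr _ _ _ _ _ _ (fun x a l => if f x a then a :: l else l)
  (fun=> [::]) s (fun x a => @esize A eA a + 1)); pt.
- by apply: (pt_comp2 pf); pt.
- exact: pbound_item.
by move=> c l a; case: (f c a); rewrite ?esize_cons; lia.
Qed.

Lemma pt_has (f : X -> A -> bool) (s : X -> seq A) :
    polytime (fun p : X * A => f p.1 p.2) -> polytime s ->
  polytime (fun x => has (f x) (s x)).
Proof.
move=> pf ps.
apply: (@pt_eq _ _ _ _ _ (fun x => foldr (fun a b => f x a || b) false (s x))).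
  by move=> x; elim: (s x) => //= a l ->.
apply: (pt_foldr (g := fun x a => 3)); pt.
- by apply: (pt_comp2 pf); pt.
- exact: pbound_const.
by move=> c l a; apply: leq_trans (esize_bool _) _; lia.
Qed.

Lemma pt_all (f : X -> A -> bool) (s : X -> seq A) :
    polytime (fun p : X * A => f p.1 p.2) -> polytime s ->
  polytime (fun x => all (f x) (s x)).
Proof.
move=> pf ps.
apply: (@pt_eq _ _ _ _ _ (fun x => ~~ has (fun a => ~~ f x a) (s x))).
  by move=> x; rewrite has_predC negbK.
by pt; apply: pt_has; pt.
Qed.

Lemma pt_cat (s t : X -> seq A) :
  polytime s -> polytime t -> polytime (fun x => s x ++ t x).
Proof.
move=> ps pt'; apply: (@pt_eq _ _ _ _ _ (fun x => catrev (rev (s x)) (t x))).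
  by move=> x; rewrite catrevE revK.
by pt.
Qed.

End SeqOps.

Lemma pt_flatten X A (eX : encodable X) (eA : encodable A) (s : X -> seq (seq A)) :
  polytime s -> polytime (fun x => flatten (s x)).
Proof.
move=> ps; apply: (@pt_foldr _ _ _ _ _ _ (fun x a l => a ++ l)
  (fun=> [::]) s (fun x a => @esize (seq A) _ a + 0)); pt; first by apply: pt_cat; pt.
  exact: pbound_item.
by move=> c l a; pose proof (esize_cat a l); lia.
Qed.

Ltac pt_base ::= first
  [ assumption | simple eapply pt_id | simple eapply pt_const
  | simple eapply pt_fst | simple eapply pt_snd | simple eapply pt_pair
  | simple eapply pt_cons | simple eapply pt_behead | simple eapply pt_head
  | simple eapply pt_nilp | simple eapply pt_if | simple eapply pt_negb
  | simple eapply pt_andb | simple eapply pt_orb | simple eapply pt_catrev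
  | simple eapply pt_rev | simple eapply pt_map | simple eapply pt_filter
  | simple eapply pt_has | simple eapply pt_all | simple eapply pt_cat
  | simple eapply pt_flatten ].

(** * Unary arithmetic and indexed access to lists *)

Section Nat.
Variables (X : Type) (eX : encodable X).
Implicit Types m n : X -> nat.

Lemma pt_nseq n : polytime n -> polytime (fun x => nseq (n x) tt).
Proof.
apply: pt_same_enc => x; elim: (n x) => // k IH.
by rewrite -[LHS]/(Node Leaf (enc (nseq k tt))) IH.
Qed.

Lemma pt_succ n : polytime n -> polytime (fun x => (n x).+1).
Proof. by move=> pn; apply: (@pt_same_enc _ _ _ _ _ _ _ (fun x => (tt, n x))); pt. Qed.

Lemma pt_pred n : polytime n -> polytime (fun x => (n x).-1).
Proof. by apply: pt_tl => x; case: (n x). Qed.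

End Nat.

Section Iter.
Variables (X : Type) (eX : encodable X).
Implicit Types m n : X -> nat.

(** Numbers are unary, so repeating a step [n] times is a fold over a list of [n] units. *)
Lemma pt_iter S (eS : encodable S) (f : X -> S -> S) (s : X -> S) n
    (g : X -> nat) :
    polytime (fun p : X * S => f p.1 p.2) -> polytime s -> polytime n ->
    pbound g -> (forall c s, esize (f c s) <= esize s + g c) ->
  polytime (fun x => iter (n x) (f x) (s x)).
Proof.
move=> pf ps pn pg h.
apply: (@pt_eq _ _ _ _ _
    (fun x => foldr (fun _ st => f x st) (s x) (nseq (n x) tt))).
  by move=> x; elim: (n x) => //= k ->.
apply: (pt_foldr (g := fun x _ => g x)); pt.
- by apply: (pt_comp2 pf); pt.
- exact: pt_nseq.
- apply: (pbound_comp (f := fst) _ pg).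
  apply: pbound_le (@pbound_esize _ _) _ => -[x a].
  by rewrite esize_pair /=; lia.
- by [].
Qed.

End Iter.

Section NatOps.
Variables (X : Type) (eX : encodable X).
Implicit Types m n : X -> nat.

Lemma pt_addn m n : polytime m -> polytime n -> polytime (fun x => m x + n x).
Proof.
move=> pm pn; apply: (@pt_eq _ _ _ _ _ (fun x => iter (m x) succn (n x))).
  by move=> x; rewrite iter_succn addnC.
apply: (pt_iter (g := fun=> 2)) => //; first by apply: pt_succ; pt.
  exact: pbound_const.
by move=> _ k; rewrite !esize_nat; lia.
Qed.

Lemma pt_subn m n : polytime m -> polytime n -> polytime (fun x => m x - n x).
Proof.
move=> pm pn; apply: (@pt_eq _ _ _ _ _ (fun x => iter (n x) predn (m x))).
  by move=> x; rewrite iter_predn.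
apply: (pt_iter (g := fun=> 0)) => //; first by apply: pt_pred; pt.
  exact: pbound_const.
by move=> _ k; rewrite !esize_nat; lia.
Qed.

Lemma pt_leq m n : polytime m -> polytime n -> polytime (fun x => m x <= n x).
Proof.
move=> pm pn; apply: (@pt_eq _ _ _ _ _ (fun x => nilp (nseq (m x - n x) tt))).
  by move=> x; rewrite /nilp size_nseq.
by pt; apply: pt_nseq; apply: pt_subn.
Qed.

Lemma pt_eqn m n : polytime m -> polytime n -> polytime (fun x => m x == n x).
Proof.
move=> pm pn; apply: (@pt_eq _ _ _ _ _ (fun x => (m x <= n x) && (n x <= m x))).
  by move=> x; rewrite eqn_leq.
by pt; apply: pt_leq.
Qed.

Lemma pt_odd n : polytime n -> polytime (fun x => odd (n x)).
Proof.
move=> pn; apply: (@pt_eq _ _ _ _ _ (fun x => iter (n x) negb false)).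
  by move=> x; elim: (n x) => //= k ->.
apply: (pt_iter (g := fun=> 3)) => //; pt.
  exact: pbound_const.
by move=> _ k; apply: leq_trans (esize_bool _) _; lia.
Qed.

End NatOps.

Ltac pt_nat := first
  [ simple eapply pt_succ | simple eapply pt_pred | simple eapply pt_addn
  | simple eapply pt_subn | simple eapply pt_leq | simple eapply pt_eqn
  | simple eapply pt_odd ].
Ltac pt_hyp :=
  match goal with H : polytime _ |- _ =>
    first [eapply (pt_comp H) | eapply (pt_comp2 H)] end.
Ltac pt ::= repeat (cbv beta; first [pt_base | pt_nat | pt_hyp]).

Section SeqNat.
Variables (X A : Type) (eX : encodable X) (eA : encodable A).
Implicit Types (s : X -> seq A) (n : X -> nat).

Lemma pt_size s : polytime s -> polytime (fun x => size (s x)).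
Proof.
move=> ps; apply: (@pt_eq _ _ _ _ _ (fun x => foldr (fun _ k => k.+1) 0 (s x))).
  by move=> x; elim: (s x) => //= a l ->.
apply: (pt_foldr (g := fun _ _ => 2)); pt; first exact: pbound_const.
by move=> _ k _; rewrite !esize_nat; lia.
Qed.

Lemma esize_behead (s : seq A) : esize (behead s) <= esize s.
Proof. by case: s => //= a s; rewrite esize_cons; lia. Qed.

Lemma pt_drop n s : polytime n -> polytime s ->
  polytime (fun x => drop (n x) (s x)).
Proof.
move=> pn ps; apply: (@pt_eq _ _ _ _ _ (fun x => iter (n x) behead (s x))).
  move=> x; elim: (n x) (s x) => [|k IH] l /=; first by rewrite drop0.
  by rewrite -IH -drop1 drop_drop.
apply: (pt_iter (g := fun=> 0)); pt; first exact: pbound_const.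
by move=> _ l; rewrite addn0 esize_behead.
Qed.

Lemma pt_take n s : polytime n -> polytime s ->
  polytime (fun x => take (n x) (s x)).
Proof.
move=> pn ps.
apply: (@pt_eq _ _ _ _ _ (fun x => rev (drop (size (s x) - n x) (rev (s x))))).
  move=> x; rewrite rev_drop revK size_rev -minnE minnC.
  by case: leqP => // /ltnW h; rewrite !take_oversize.
by pt; apply: pt_drop; pt; apply: pt_size.
Qed.

Lemma pt_nth (a : X -> A) n s : polytime a -> polytime n -> polytime s ->
  polytime (fun x => nth (a x) (s x) (n x)).
Proof.
move=> pa pn ps.
apply: (@pt_eq _ _ _ _ _ (fun x => head (a x) (drop (n x) (s x)))).
  by move=> x; rewrite -nth0 nth_drop addn0.
by pt; apply: pt_drop.
Qed.

Lemma pt_count (f : X -> A -> bool) s :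
    polytime (fun p : X * A => f p.1 p.2) -> polytime s ->
  polytime (fun x => count (f x) (s x)).
Proof.
move=> pf ps; apply: (@pt_eq _ _ _ _ _ (fun x => size (filter (f x) (s x)))).
  by move=> x; rewrite size_filter.
by apply: pt_size; pt.
Qed.

Lemma pt_last (a : X -> A) s : polytime a -> polytime s ->
  polytime (fun x => last (a x) (s x)).
Proof.
move=> pa ps; apply: (@pt_eq _ _ _ _ _ (fun x => head (a x) (rev (s x)))).
  by move=> x; case/lastP: (s x) => // l b; rewrite last_rcons rev_rcons.
by pt.
Qed.

End SeqNat.

Lemma pt_iota X (eX : encodable X) (n : X -> nat) :
  polytime n -> polytime (fun x => iota 0 (n x)).
Proof.
(* The test never fails during the [n x] rounds; it makes the growth bounded for every list [l], as
   [pt_iter] demands. *)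
move=> pn; pose f x (l : seq nat) := if size l < n x then size l :: l else l.
apply: (@pt_eq _ _ _ _ _ (fun x => rev (iter (n x) (f x) [::]))).
  move=> x; rewrite -[LHS]revK; congr rev.
  have h k : k <= n x -> iter k (f x) [::] = rev (iota 0 k).
    elim: k => // k IH lt; rewrite iterS IH ?(ltnW lt) // /f size_rev size_iota.
    by rewrite lt -[in RHS]addn1 iotaD rev_cat.
  by rewrite h.
pt; apply: (pt_iter (g := fun x => esize (n x) + 1)); rewrite /f; pt;
  try exact: pt_size pt_id.
- by apply: pt_size; pt.
- by apply: pt_size; pt.
- by apply: pboundD; [apply: polytime_size | apply: pbound_const].
- move=> x l; rewrite /f; case: ltnP => h; last by lia.
  by rewrite esize_cons !esize_nat; lia.
Qed.

Lemma pt_zip X A B (eX : encodable X) (eA : encodable A) (eB : encodable B)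
    (b0 : B) (s : X -> seq A) (t : X -> seq B) :
  polytime s -> polytime t -> polytime (fun x => zip (s x) (t x)).
Proof.
move=> ps pt'.
pose f (st : seq B * seq (A * B)) (a : A) :=
  if nilp st.1 then st else (behead st.1, (a, head b0 st.1) :: st.2).
apply: (@pt_eq _ _ _ _ _ (fun x => rev (foldl f (t x, [::]) (s x)).2)).
  move=> x; have h l u r : (foldl f (u, r) l).2 = rev (zip l u) ++ r.
    elim: l u r => [|a l IH] [|b u] r //=; last first.
      by rewrite IH rev_cons cat_rcons.
    by rewrite /f /= IH; case: (l).
  by rewrite h cats0 revK.
pt; apply: (pt_foldl (g := fun _ a => @esize A eA a + 10)); rewrite /f; pt.
  exact: pbound_item.
move=> _ [[|b u] r] a /=; first by lia.
by rewrite !esize_pair /= !esize_cons !esize_pair /=; lia.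
Qed.

Definition eq_polytime (T : eqType) (eT : encodable T) :=
  polytime (fun p : T * T => p.1 == p.2).

Lemma eq_polytime_nat : eq_polytime encodable_nat.
Proof. by rewrite /eq_polytime; pt. Qed.

Lemma eq_polytime_prod (T U : eqType) (eT : encodable T) (eU : encodable U) :
  eq_polytime eT -> eq_polytime eU ->
  eq_polytime (encodable_prod (H := eT) (H0 := eU)).
Proof.
move=> pT pU; apply: (@pt_eq _ _ _ _ _
    (fun p : (T * U) * (T * U) => (p.1.1 == p.2.1) && (p.1.2 == p.2.2))).
  by case=> -[a b] [c d].
by pt; [apply: (pt_comp2 pT)|apply: (pt_comp2 pU)]; pt.
Qed.

Lemma pt_eqop X (T : eqType) (eX : encodable X) (eT : encodable T)
    (f g : X -> T) :
  eq_polytime eT -> polytime f -> polytime g -> polytime (fun x => f x == g x).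
Proof. by move=> pT pf pg; apply: (pt_comp2 pT). Qed.

Lemma pt_mem X (T : eqType) (eX : encodable X) (eT : encodable T)
    (f : X -> T) (s : X -> seq T) :
  eq_polytime eT -> polytime f -> polytime s -> polytime (fun x => f x \in s x).
Proof.
move=> pT pf ps; apply: (@pt_eq _ _ _ _ _ (fun x => has (pred1 (f x)) (s x))).
  by move=> x; rewrite has_pred1.
apply: (@pt_has _ _ _ _ (fun x a => a == f x)) => //.
by apply: pt_eqop => //; pt; apply: (pt_comp pf); pt.
Qed.

Lemma pt_uniq X (T : eqType) (eX : encodable X) (eT : encodable T)
    (s : X -> seq T) :
  eq_polytime eT -> polytime s -> polytime (fun x => uniq (s x)).
Proof.
(* [take 1 (drop i _)] holds the item of index [i] as a list, which avoids choosing a default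
   element. *)
move=> pT ps; apply: (@pt_eq _ _ _ _ _ (fun x => all (fun i =>
   all (fun a => a \notin drop i.+1 (s x)) (take 1 (drop i (s x))))
   (iota 0 (size (s x))))).
  move=> x; elim: (s x) => //= a l ->; rewrite take0 /= drop0 andbT.
  congr (_ && _); rewrite (iotaDl 1) all_map; apply: eq_all => i /=.
  by rewrite add1n.
pt; last by apply: pt_iota; apply: pt_size; pt.
  apply: pt_mem => //; pt; apply: pt_drop; pt; by apply: (pt_comp ps); pt.
by apply: pt_take; pt; apply: pt_drop; pt; apply: (pt_comp ps); pt.
Qed.

(** * The algorithm *)

Ltac pt_seq := first
  [ simple eapply pt_size | simple eapply pt_drop | simple eapply pt_take
  | simple eapply pt_nth | simple eapply pt_count | simple eapply pt_last
  | simple eapply pt_iota | simple eapply pt_mem | simple eapply pt_uniq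
  | simple eapply pt_eqop | simple eapply eq_polytime_nat
  | simple eapply eq_polytime_prod ].
Ltac pt ::= repeat (cbv beta; first [pt_base | pt_nat | pt_seq | pt_hyp]).

(* A dart (e, (x, y)) is the edge number e traversed from x to y. *)
Notation dart := (nat * (nat * nat))%type.
Notation src d := (d.2.1) (only parsing).
Notation dst d := (d.2.2) (only parsing).

Definition drev (d : dart) : dart := (d.1, (dst d, src d)).
Definition wrev (s : seq dart) := rev (map drev s).
Definition edges (s : seq dart) := map fst s.
Definition start (s : seq dart) : nat := src (head (0, (0, 0)) s).
Definition finish (s : seq dart) : nat := dst (last (0, (0, 0)) s).

Definition darts (E : seq (nat * nat)) : seq dart :=
  let D := [seq (i, nth (0, 0) E i) | i <- iota 0 (size E)] in D ++ map drev D.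

Definition reached (s : nat) (t : seq dart) (x : nat) :=
  (x == s) || (x \in [seq dst d | d <- t]).

Definition bfs_step (s : nat) (t : seq dart) (d : dart) :=
  if reached s t (src d) && ~~ reached s t (dst d) then d :: t else t.

(** Each pass over [A] adds a dart unless the tree is already closed, and the tree has at most
    [size A] darts, so this many passes suffice. *)
Definition bfs (s : nat) (A : seq dart) :=
  iter (size A) (fun t => foldl (bfs_step s) t A) [::].

(* A search tree lists its latest dart first, so that a single pass goes back
   from y to the root. *)
Definition trace_step (st : nat * seq dart) (d : dart) :=
  if dst d == st.1 then (src d, d :: st.2) else st.

Definition trace (t : seq dart) (y : nat) := (foldl trace_step (y, [::]) t).2.

Definition residual (D F : seq dart) :=
  [seq d <- D | (d.1 \notin edges F) || (drev d \in F)].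

Definition augment (D : seq dart) (s t : nat) (F : seq dart) :=
  let T := bfs s (residual D F) in
  let p := trace T t in
  if reached s T t then
    [seq f <- F | drev f \notin p] ++ [seq d <- p | drev d \notin F]
  else F.

Definition flow D s t n := iter n (augment D s t) [::].

(** The search runs over [D] filtered by the flow, not over the flow itself: the result is then
    bounded by the size of [D] whatever the state, so that iteration adds a bounded amount each
    time. *)
Definition peel (D : seq dart) (s t : nat) (st : seq dart * seq (seq dart)) :=
  let p := trace (bfs s [seq d <- D | d \in st.1]) t in
  ([seq f <- st.1 | f \notin p], p :: st.2).

Definition disjoint_paths (D : seq dart) (s t n : nat) :=
  (iter n (peel D s t) (flow D s t n, [::])).2.

Definition edisj (s t : seq dart) := all (fun e => e \notin edges t) (edges s).
Definition adj (s : seq dart) := zip s (behead s).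
Definition chain (s : seq dart) := all (fun p => dst p.1 == src p.2) (adj s).
Definition otrail (u v : nat) (w : seq dart) :=
  [&& chain w, uniq (edges w), odd (size w), start w \in [:: u; v]
    & finish w \in [:: u; v]].

(* The turns of w that follow no path; Qs holds the paths in both
   orientations. *)
Definition breaks (Qs : seq (seq dart)) (w : seq dart) :=
  count (fun p => ~~ has (fun Q => p \in adj Q) Qs) (adj w).

Definition prefixes (s : seq dart) := [seq take i s | i <- iota 0 (size s).+1].
Definition suffixes (s : seq dart) := [seq drop i s | i <- iota 0 (size s).+1].

(** All prefixes and suffixes are combined, whether they fit together or not. The tests made by
    [better] and [convert] discard the others, so the point of contact need not be computed. *)
Definition splices (T Q : seq dart) :=
  flatten [seq [seq a ++ b | b <- suffixes T ++ suffixes (wrev T)]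
             | a <- prefixes Q].

Definition picks (Ts : seq (seq dart)) :=
  [seq (nth [::] Ts i, take i Ts ++ drop i.+1 Ts) | i <- iota 0 (size Ts)].

Definition better u v Qs (p : seq dart * seq (seq dart)) (w : seq dart) :=
  [&& otrail u v w, all (edisj w) p.2 & breaks Qs w < breaks Qs p.1].

Definition improvements u v Qs Ts :=
  flatten [seq flatten [seq [seq w :: p.2 | w <- splices p.1 Q & better u v Qs p w]
                          | Q <- Qs] | p <- picks Ts].

Definition improve u v Qs Ts := head Ts (improvements u v Qs Ts).

(* There are at most size (flatten Ts) breaks to remove. *)
Definition reduce u v Qs Ts := iter (size (flatten Ts)) (improve u v Qs) Ts.

(* The default value p.1 is never used: a suitable splice always exists, even
   for p.2 = [::] when p.1 already joins u to v. *)
Definition convert (u v : nat) (p : seq dart * seq dart) :=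
  head p.1 [seq w <- splices p.1 p.2 ++ splices p.1 (wrev p.2)
              | otrail u v w & start w != finish w].

Definition private (Ps : seq (seq dart)) (p : seq dart * seq (seq dart)) :=
  [seq P <- Ps | ~~ edisj P p.1 & all (edisj P) p.2].

Definition untouched (Ps Ts : seq (seq dart)) :=
  [seq P <- Ps | all (edisj P) Ts].

Definition served Ps (p : seq dart * seq (seq dart)) :=
  (start p.1 != finish p.1) || ~~ nilp (private Ps p).

Definition assignment Ps Ts :=
  [seq (p.1, head [::] (private Ps p)) | p <- picks Ts & served Ps p] ++
  zip [seq p.1 | p <- picks Ts & ~~ served Ps p] (untouched Ps Ts).

Definition darts_of (w : nat * seq (nat * nat)) : seq dart :=
  rev (foldl (fun st a => (a.2, (a.1, (st.1, a.2)) :: st.2)) (w.1, [::]) w.2).2.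

Definition walk_of u (w : seq dart) : nat * seq (nat * nat) :=
  (u, [seq (d.1, dst d) | d <- if start w == u then w else wrev w]).

Definition pack (E : seq (nat * nat)) (u v : nat) (Ts : seq (seq dart)) :=
  let k := size Ts in
  let Ps := disjoint_paths (darts E) v u (k + k) in
  let Ts' := reduce u v (Ps ++ map wrev Ps) Ts in
  [seq walk_of u (convert u v p) | p <- assignment Ps Ts'].

Definition solve (I : (nat * seq (nat * nat)) *
    ((nat * nat) * seq (nat * seq (nat * nat)))) :=
  pack I.1.2 I.2.1.1 I.2.1.2 (map darts_of I.2.2).

(** * Running time of the algorithm *)

Section PolytimeDarts.
Variables (X : Type) (eX : encodable X).

Lemma pt_drev (d : X -> dart) : polytime d -> polytime (fun x => drev (d x)).
Proof. by move=> *; rewrite /drev; pt. Qed.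

Lemma pt_edges (s : X -> seq dart) : polytime s -> polytime (fun x => edges (s x)).
Proof. by move=> *; rewrite /edges; pt. Qed.

Lemma pt_start (s : X -> seq dart) : polytime s -> polytime (fun x => start (s x)).
Proof. by move=> *; rewrite /start; pt. Qed.

Lemma pt_finish (s : X -> seq dart) : polytime s -> polytime (fun x => finish (s x)).
Proof. by move=> *; rewrite /finish; pt. Qed.

Lemma pt_adj (s : X -> seq dart) : polytime s -> polytime (fun x => adj (s x)).
Proof. by move=> ?; apply: (pt_zip (0, (0, 0))); pt. Qed.

Lemma pt_reached (s : X -> nat) (t : X -> seq dart) (y : X -> nat) :
  polytime s -> polytime t -> polytime y ->
  polytime (fun x => reached (s x) (t x) (y x)).
Proof. by move=> *; rewrite /reached; pt. Qed.

End PolytimeDarts.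

Ltac pt_dart := first
  [ simple eapply pt_drev | simple eapply pt_edges | simple eapply pt_start
  | simple eapply pt_finish | simple eapply pt_adj | simple eapply pt_reached ].
Ltac pt ::= repeat (cbv beta; first [pt_base | pt_nat | pt_seq | pt_dart | pt_hyp]).

Lemma mem_picks Ts (p : seq dart * seq (seq dart)) :
  p \in picks Ts -> perm_eq Ts (p.1 :: p.2).
Proof.
case/mapP=> i; rewrite mem_iota add0n => /= lt ->.
by rewrite -[X in perm_eq X](cat_take_drop i) (drop_nth [::]) //= -cat1s perm_catCA.
Qed.

Lemma esize_filter A `{encodable A} a (s : seq A) :
  esize (filter a s) <= esize s.
Proof.
by elim: s => //= x s IH; case: (a x); rewrite !esize_cons; lia.
Qed.

Lemma esize_mem (Q : seq dart) (s : seq (seq dart)) :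
  Q \in s -> esize Q <= esize s.
Proof.
elim: s => // P s IH; rewrite inE => /predU1P[->|/IH h]; rewrite esize_cons; lia.
Qed.

Lemma esize_perm (T : eqType) `{encodable T} (s t : seq T) :
  perm_eq s t -> esize s = esize t.
Proof.
have h (r : seq T) : esize r = (\sum_(x <- r) (esize x).+1).+1.
  elim: r => [|x r IH]; first by rewrite big_nil.
  by rewrite big_cons esize_cons IH; lia.
by move=> st; rewrite !h (perm_big _ st).
Qed.

Lemma esize_wrev s : esize (wrev s) = esize s.
Proof.
have -> : esize (wrev s) = esize (map drev s) by apply: esize_perm; rewrite perm_rev.
elim: s => //= d s IH; rewrite !esize_cons IH !esize_pair /=; lia.
Qed.

Lemma esize_take i (s : seq dart) : esize (take i s) <= esize s.
Proof.
pose proof (esize_cat (take i s) (drop i s)) as h; rewrite cat_take_drop in h.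
pose proof (esize_gt0 (drop i s)); lia.
Qed.

Lemma esize_drop i (s : seq dart) : esize (drop i s) <= esize s.
Proof.
pose proof (esize_cat (take i s) (drop i s)) as h; rewrite cat_take_drop in h.
pose proof (esize_gt0 (take i s)); lia.
Qed.

Lemma mem_prefixes (s a : seq dart) :
  reflect (exists i, a = take i s) (a \in prefixes s).
Proof.
apply: (iffP mapP) => [[i _ ->]|[i ->]]; first by exists i.
exists (minn i (size s)); first by rewrite mem_iota add0n ltnS geq_minr.
by case: leqP => // h; rewrite take_oversize ?take_size // ltnW.
Qed.

Lemma mem_suffixes (s a : seq dart) :
  reflect (exists i, a = drop i s) (a \in suffixes s).
Proof.
apply: (iffP mapP) => [[i _ ->]|[i ->]]; first by exists i.
exists (minn i (size s)); first by rewrite mem_iota add0n ltnS geq_minr.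
by case: leqP => // h; rewrite drop_oversize ?drop_size // ltnW.
Qed.

Lemma mem_splices (T Q w : seq dart) :
  reflect (exists i j (T' : seq dart),
             T' \in [:: T; wrev T] /\ w = take i Q ++ drop j T')
          (w \in splices T Q).
Proof.
apply: (iffP flattenP) => [[_ /mapP[_ /mem_prefixes[i ->] ->] /mapP[b]]|].
  rewrite mem_cat => /orP[] /mem_suffixes[j ->] ->.
    by exists i, j, T; rewrite mem_head.
  by exists i, j, (wrev T); rewrite mem_seq2 eqxx orbT.
move=> [i [j [T' [hT ->]]]].
exists [seq take i Q ++ b | b <- suffixes T ++ suffixes (wrev T)].
  by apply/mapP; exists (take i Q) => //; apply/mem_prefixes; exists i.
apply/mapP; exists (drop j T') => //; rewrite mem_cat; move: hT; rewrite mem_seq2.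
by case/pred2P=> ->; apply/orP; [left | right]; apply/mem_suffixes; exists j.
Qed.

Lemma esize_splices (T Q w : seq dart) :
  w \in splices T Q -> (esize w).+1 <= esize Q + esize T.
Proof.
move=> /mem_splices[i [j [T' [hT ->]]]]; rewrite esize_cat.
apply: leq_add; first exact: esize_take.
apply: leq_trans (esize_drop _ _) _; move: hT; rewrite mem_seq2.
by case/pred2P=> ->; rewrite ?esize_wrev.
Qed.

Lemma mem_improvements u v Qs Ts Ts' :
  reflect (exists (p : seq dart * seq (seq dart)) (Q w : seq dart),
             [/\ p \in picks Ts, Q \in Qs, w \in splices p.1 Q,
             better u v Qs p w & Ts' = w :: p.2])
          (Ts' \in improvements u v Qs Ts).
Proof.
apply: (iffP flattenP).
  case=> _ /mapP[p hp ->] /flattenP[_ /mapP[Q hQ ->] /mapP[w]].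
  by rewrite mem_filter => /andP[bw hw] ->; exists p, Q, w.
case=> p [Q [w [hp hQ hw bw ->]]].
exists (flatten [seq [seq w :: p.2 | w <- splices p.1 Q & better u v Qs p w]
                          | Q <- Qs]); first by apply/mapP; exists p.
apply/flattenP; exists [seq w :: p.2 | w <- splices p.1 Q & better u v Qs p w].
  by apply/mapP; exists Q.
by apply/mapP; exists w; rewrite // mem_filter bw.
Qed.

Lemma mem_head_or (T : eqType) (x : T) s : (head x s \in s) || nilp s.
Proof. by case: s => // y s; rewrite mem_head. Qed.

Lemma improveP u v Qs Ts :
  (improve u v Qs Ts = Ts /\ improvements u v Qs Ts = [::]) \/
  exists (p : seq dart * seq (seq dart)) (Q w : seq dart),
    [/\ p \in picks Ts, Q \in Qs, w \in splices p.1 Q,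
        better u v Qs p w & improve u v Qs Ts = w :: p.2].
Proof.
have := mem_head_or Ts (improvements u v Qs Ts).
case/orP=> [/mem_improvements|/nilP h]; first by right.
by left; rewrite /improve h.
Qed.

(** The additive growth required of an iterated state: a splice is smaller than its trail and its
    path together, so one replacement costs at most the size of a path. *)
Lemma esize_improve u v Qs Ts : esize (improve u v Qs Ts) <= esize Ts + esize Qs.
Proof.
case: (improveP u v Qs Ts) => [[-> _]|[p [Q [w [hp hQ hw _ ->]]]]].
  exact: leq_addr.
have -> : esize Ts = esize (p.1 :: p.2) by apply: esize_perm (mem_picks hp).
have := esize_splices hw; rewrite !esize_cons.
by have := esize_mem hQ; lia.
Qed.

Lemma esize_bfs s A : esize (bfs s A) <= esize A * esize A + 1.
Proof.
rewrite /bfs; have hs t d : esize (bfs_step s t d) <= esize t + (esize d + 1).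
  by rewrite /bfs_step; case: ifP => _; rewrite ?esize_cons; lia.
have hf t B : esize (foldl (bfs_step s) t B) <= esize t + esize B.
  elim: B t => [|d B IH] t /=; first by lia.
  by apply: leq_trans (IH _) _; rewrite esize_cons; have := hs t d; lia.
have hi n : esize (iter n (fun t => foldl (bfs_step s) t A) [::]) <= n * esize A + 1.
  elim: n => // n IH; rewrite iterS; apply: leq_trans (hf _ _) _.
  by rewrite mulSn; lia.
apply: leq_trans (hi _) _; rewrite leq_add2r leq_mul2r.
by pose proof (size_esize A); apply/orP; right; apply: ltnW.
Qed.

Lemma esize_trace t y : esize (trace t y) <= esize t.
Proof.
have h st : esize (foldl trace_step st t).2 < esize st.2 + esize t; last first.
  exact: h (y, [::]).
elim: t st => [|d t IH] st /=; first by rewrite addn1.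
apply: leq_trans (IH _) _; rewrite esize_cons /trace_step.
by case: ifP => _; rewrite /= ?esize_cons; lia.
Qed.

Section PolytimeSearch.
Variables (X : Type) (eX : encodable X).

Lemma pt_wrev (s : X -> seq dart) : polytime s -> polytime (fun x => wrev (s x)).
Proof. by move=> *; rewrite /wrev; pt. Qed.

Lemma pt_darts (E : X -> seq (nat * nat)) :
  polytime E -> polytime (fun x => darts (E x)).
Proof. by move=> *; rewrite /darts; pt. Qed.

Lemma pt_bfs_round (s : X -> nat) (t A : X -> seq dart) :
  polytime s -> polytime t -> polytime A ->
  polytime (fun x => foldl (bfs_step (s x)) (t x) (A x)).
Proof.
move=> *; apply: (pt_foldl (g := fun _ d => @esize dart _ d + 1));
  rewrite /bfs_step; pt.
  exact: pbound_item.
by move=> c st d; case: ifP => _; rewrite ?esize_cons; lia.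
Qed.

Lemma pt_trace (t : X -> seq dart) (y : X -> nat) :
  polytime t -> polytime y -> polytime (fun x => trace (t x) (y x)).
Proof.
move=> *; rewrite /trace; pt.
apply: (pt_foldl (g := fun _ d => (@esize dart _ d + 2) + (@esize dart _ d + 2)));
  rewrite /trace_step; pt; first by apply: pboundD; apply: pbound_item.
move=> c st d; case: ifP => _; last by lia.
by rewrite !esize_pair /= !esize_cons !esize_pair; lia.
Qed.

Lemma pt_residual (D F : X -> seq dart) :
  polytime D -> polytime F -> polytime (fun x => residual (D x) (F x)).
Proof. by move=> *; rewrite /residual; pt. Qed.

Lemma pt_edisj (s t : X -> seq dart) :
  polytime s -> polytime t -> polytime (fun x => edisj (s x) (t x)).
Proof. by move=> *; rewrite /edisj; pt. Qed.

Lemma pt_chain (s : X -> seq dart) : polytime s -> polytime (fun x => chain (s x)).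
Proof. by move=> *; rewrite /chain; pt. Qed.

Lemma pt_prefixes (s : X -> seq dart) :
  polytime s -> polytime (fun x => prefixes (s x)).
Proof. by move=> *; rewrite /prefixes; pt. Qed.

Lemma pt_suffixes (s : X -> seq dart) :
  polytime s -> polytime (fun x => suffixes (s x)).
Proof. by move=> *; rewrite /suffixes; pt. Qed.

Lemma pt_picks (Ts : X -> seq (seq dart)) :
  polytime Ts -> polytime (fun x => picks (Ts x)).
Proof. by move=> *; rewrite /picks; pt. Qed.

Lemma pt_darts_of (w : X -> nat * seq (nat * nat)) :
  polytime w -> polytime (fun x => darts_of (w x)).
Proof.
move=> *; rewrite /darts_of; pt.
apply: (pt_foldl (g := fun _ a =>
  (@esize (nat * nat) _ a + 5) + (@esize (nat * nat) _ a + 5))); pt.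
  by apply: pboundD; apply: pbound_item.
by move=> _ [y l] [e z]; rewrite /= !esize_pair /= !esize_cons !esize_pair /=; lia.
Qed.

End PolytimeSearch.

Ltac pt_search := first
  [ simple eapply pt_wrev | simple eapply pt_darts | simple eapply pt_bfs_round
  | simple eapply pt_trace | simple eapply pt_residual | simple eapply pt_edisj
  | simple eapply pt_chain | simple eapply pt_prefixes
  | simple eapply pt_suffixes | simple eapply pt_picks
  | simple eapply pt_darts_of ].
Ltac pt ::= repeat (cbv beta;
  first [pt_base | pt_nat | pt_seq | pt_dart | pt_search | pt_hyp]).

Section PolytimeTrails.
Variables (X : Type) (eX : encodable X).

Lemma pt_bfs (s : X -> nat) (A : X -> seq dart) :
  polytime s -> polytime A -> polytime (fun x => bfs (s x) (A x)).
Proof.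
move=> *; rewrite /bfs.
apply: (pt_iter (g := fun x => esize (A x))); pt; first exact: polytime_size.
move=> c t; elim: (A c) t => [|d B IH] t /=; first by lia.
apply: leq_trans (IH _) _; rewrite esize_cons /bfs_step.
by case: ifP => _; rewrite ?esize_cons; lia.
Qed.

Lemma pt_otrail (u v : X -> nat) (w : X -> seq dart) :
  polytime u -> polytime v -> polytime w ->
  polytime (fun x => otrail (u x) (v x) (w x)).
Proof. by move=> *; rewrite /otrail; pt. Qed.

Lemma pt_breaks (Qs : X -> seq (seq dart)) (w : X -> seq dart) :
  polytime Qs -> polytime w -> polytime (fun x => breaks (Qs x) (w x)).
Proof. by move=> *; rewrite /breaks; pt. Qed.

Lemma pt_splices (T Q : X -> seq dart) :
  polytime T -> polytime Q -> polytime (fun x => splices (T x) (Q x)).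
Proof. by move=> *; rewrite /splices; pt. Qed.

Lemma pt_private (Ps : X -> seq (seq dart)) (p : X -> seq dart * seq (seq dart)) :
  polytime Ps -> polytime p -> polytime (fun x => private (Ps x) (p x)).
Proof. by move=> *; rewrite /private; pt. Qed.

Lemma pt_untouched (Ps Ts : X -> seq (seq dart)) :
  polytime Ps -> polytime Ts -> polytime (fun x => untouched (Ps x) (Ts x)).
Proof. by move=> *; rewrite /untouched; pt. Qed.

Lemma pt_walk_of (u : X -> nat) (w : X -> seq dart) :
  polytime u -> polytime w -> polytime (fun x => walk_of (u x) (w x)).
Proof. by move=> *; rewrite /walk_of; pt. Qed.

End PolytimeTrails.

Ltac pt_trail := first
  [ simple eapply pt_bfs | simple eapply pt_otrail | simple eapply pt_breaks
  | simple eapply pt_splices | simple eapply pt_private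
  | simple eapply pt_untouched | simple eapply pt_walk_of ].
Ltac pt ::= repeat (cbv beta;
  first [pt_base | pt_nat | pt_seq | pt_dart | pt_search | pt_trail | pt_hyp]).

Lemma esize_augment D s t F :
  esize (augment D s t F) <= esize F + (esize D * esize D + 1).
Proof.
rewrite /augment; case: ifP => _; last exact: leq_addr.
set p := trace _ t.
have hp : esize p <= esize D * esize D + 1.
  apply: leq_trans (esize_trace _ _) (leq_trans (esize_bfs _ _) _).
  by rewrite leq_add2r leq_mul // esize_filter.
rewrite -ltnS esize_cat; apply: leq_trans (leqnSn _).
apply: leq_add; first exact: esize_filter.
exact: leq_trans (esize_filter _ _) hp.
Qed.

Lemma esize_peel D s t st :
  esize (peel D s t st) <= esize st + (esize D * esize D + 1).+1.
Proof.
rewrite /peel; set p := trace _ t; rewrite !esize_pair /= esize_cons.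
have hp : esize p <= esize D * esize D + 1.
  apply: leq_trans (esize_trace _ _) (leq_trans (esize_bfs _ _) _).
  by rewrite leq_add2r leq_mul // esize_filter.
have h : esize [seq f <- st.1 | f \notin p] <= esize st.1 by apply: esize_filter.
rewrite addSn addnS !ltnS addnS ltnS -addnA (addnC (esize st.2)).
by rewrite leq_add // leq_add2r.
Qed.

Lemma pbound_esize_square X A (eX : encodable X) (eA : encodable A) (f : X -> A) n :
  polytime f -> pbound (fun x => esize (f x) * esize (f x) + n).
Proof.
move=> pf; apply: pboundD; last exact: pbound_const.
by apply: pboundM; apply: polytime_size.
Qed.

Section PolytimeSteps.
Variables (X : Type) (eX : encodable X).

Lemma pt_better (u v : X -> nat) (Qs : X -> seq (seq dart))
    (p : X -> seq dart * seq (seq dart)) (w : X -> seq dart) :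
  polytime u -> polytime v -> polytime Qs -> polytime p -> polytime w ->
  polytime (fun x => better (u x) (v x) (Qs x) (p x) (w x)).
Proof. by move=> *; rewrite /better; pt. Qed.

Lemma pt_convert (u v : X -> nat) (p : X -> seq dart * seq dart) :
  polytime u -> polytime v -> polytime p ->
  polytime (fun x => convert (u x) (v x) (p x)).
Proof. by move=> *; rewrite /convert; pt. Qed.

Lemma pt_served (Ps : X -> seq (seq dart)) (p : X -> seq dart * seq (seq dart)) :
  polytime Ps -> polytime p -> polytime (fun x => served (Ps x) (p x)).
Proof. by move=> *; rewrite /served; pt. Qed.

End PolytimeSteps.

Ltac pt_step := first
  [ simple eapply pt_better | simple eapply pt_convert | simple eapply pt_served ].
Ltac pt ::= repeat (cbv beta;
  first [pt_base | pt_nat | pt_seq | pt_dart | pt_search | pt_trail | pt_step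
        | pt_hyp]).

Section PolytimeLoops.
Variables (X : Type) (eX : encodable X).

Lemma pt_flow (D : X -> seq dart) (s t n : X -> nat) :
  polytime D -> polytime s -> polytime t -> polytime n ->
  polytime (fun x => flow (D x) (s x) (t x) (n x)).
Proof.
move=> pD ps pt' pn; rewrite /flow.
apply: (pt_iter (g := fun x => esize (D x) * esize (D x) + 1));
  rewrite /augment; pt.
  exact: pbound_esize_square.
by move=> c F; apply: esize_augment.
Qed.

Lemma pt_disjoint_paths (D : X -> seq dart) (s t n : X -> nat) :
  polytime D -> polytime s -> polytime t -> polytime n ->
  polytime (fun x => disjoint_paths (D x) (s x) (t x) (n x)).
Proof.
move=> pD *; rewrite /disjoint_paths; pt.
apply: (pt_iter (g := fun x => (esize (D x) * esize (D x) + 2))); rewrite /peel; pt.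
- exact: pt_flow.
- exact: pbound_esize_square.
- by move=> c st; rewrite addnS; apply: esize_peel.
Qed.

Lemma pt_reduce (u v : X -> nat) (Qs Ts : X -> seq (seq dart)) :
  polytime u -> polytime v -> polytime Qs -> polytime Ts ->
  polytime (fun x => reduce (u x) (v x) (Qs x) (Ts x)).
Proof.
move=> *; rewrite /reduce.
apply: (pt_iter (g := fun x => esize (Qs x))); rewrite /improve /improvements; pt.
  exact: polytime_size.
by move=> c st; apply: esize_improve.
Qed.

Lemma pt_assignment (Ps Ts : X -> seq (seq dart)) :
  polytime Ps -> polytime Ts -> polytime (fun x => assignment (Ps x) (Ts x)).
Proof. by move=> *; rewrite /assignment; pt; apply: (pt_zip [::]); pt. Qed.

End PolytimeLoops.

Lemma polytime_solve : polytime solve.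
Proof.
rewrite /solve /pack; pt; first apply: pt_assignment; pt.
  by apply: pt_disjoint_paths; pt.
by apply: pt_reduce; pt; apply: pt_disjoint_paths; pt.
Qed.

(** * Disjoint paths from a flow *)

Lemma drevK : involutive drev.
Proof. by case=> e [x y]. Qed.

Lemma mem_darts E (d : dart) : (d \in darts E) =
  (d.1 < size E) &&
  ((nth (0, 0) E d.1 == d.2) || (nth (0, 0) E d.1 == (dst d, src d))).
Proof.
have h (d' : dart) : (d' \in [seq (i, nth (0, 0) E i) | i <- iota 0 (size E)]) =
    (d'.1 < size E) && (nth (0, 0) E d'.1 == d'.2).
  apply/mapP/andP=> [[i]|[lt /eqP eq]].
    by rewrite mem_iota add0n => /= lt ->.
  exists d'.1; first by rewrite mem_iota add0n.
  by rewrite eq; case: d' {lt eq}.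
rewrite /darts mem_cat h andb_orr; congr orb.
rewrite -[d in LHS]drevK (mem_map (can_inj drevK)) h.
by case: d => e [x y].
Qed.

Lemma drev_darts E d : (drev d \in darts E) = (d \in darts E).
Proof. by rewrite !mem_darts /= orbC; case: d => e [x y]. Qed.

Lemma same_edge E (d d' : dart) :
  d \in darts E -> d' \in darts E -> d.1 = d'.1 -> d = d' \/ d = drev d'.
Proof.
case: d d' => [e [x y]] [e' [x' y']]; rewrite !mem_darts /= => + + ee'.
rewrite -{}ee' => /andP[_ /pred2P h] /andP[_ /pred2P h'].
rewrite /drev /=; case: h h' => -> [] [-> ->]; by [left | right].
Qed.

Fixpoint wok (x : nat) (s : seq dart) (y : nat) : bool :=
  if s is d :: s' then (src d == x) && wok (dst d) s' y else x == y.

Lemma wok_cat x s t z :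
  wok x (s ++ t) z = wok x s (last x [seq dst d | d <- s]) &&
                     wok (last x [seq dst d | d <- s]) t z.
Proof. by elim: s x => [|d s IH] x /=; rewrite ?eqxx // IH andbA. Qed.

Lemma wok_last x s y : wok x s y -> last x [seq dst d | d <- s] = y.
Proof. by elim: s x => [|d s IH] x /=; [move/eqP | case/andP=> _ /IH]. Qed.

Lemma wok_catP x s t z :
  reflect (exists2 y, wok x s y & wok y t z) (wok x (s ++ t) z).
Proof.
rewrite wok_cat; apply: (iffP andP) => [[h1 h2]|[y h1 h2]].
  by exists (last x [seq dst d | d <- s]).
by rewrite (wok_last h1).
Qed.

Lemma wok_wrev x s y : wok x s y -> wok y (wrev s) x.
Proof.
elim: s x => [|d s IH] x /=; first by rewrite eq_sym.
case/andP=> /eqP <- /IH h; rewrite /wrev /= rev_cons -cats1.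
by apply/wok_catP; exists (dst d); rewrite //= eqxx eqxx.
Qed.

Lemma wrevK : involutive wrev.
Proof. by move=> s; rewrite /wrev map_rev revK (mapK drevK). Qed.

Lemma edges_wrev s : edges (wrev s) = rev (edges s).
Proof. by rewrite /edges /wrev map_rev -map_comp; congr rev; apply: eq_map. Qed.

Lemma mem_wrev s d : (d \in wrev s) = (drev d \in s).
Proof. by rewrite /wrev mem_rev -{1}[d]drevK mem_map //; apply: can_inj drevK. Qed.

Lemma size_wrev s : size (wrev s) = size s.
Proof. by rewrite size_rev size_map. Qed.

(** Telescoping: along a walk, each inner vertex is the head of one dart and the tail of the
    next. *)
Lemma wok_count (X : pred nat) x s y : wok x s y ->
  count (fun d => X (src d)) s + X y = count (fun d => X (dst d)) s + X x.
Proof.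
elim: s x => [|d s IH] x /=; first by move/eqP->.
by case/andP=> /eqP <- /IH; lia.
Qed.

Section Bfs.
Variables (s : nat) (A : seq dart).

(** The history of a search, latest dart first: each dart was added from a reached vertex to a new
    one, so the heads are distinct and the darts form a tree rooted at [s]. *)
Fixpoint grown (t : seq dart) : bool :=
  if t is d :: t' then
    [&& reached s t' (src d), ~~ reached s t' (dst d) & grown t']
  else true.

Definition closed_reach t :=
  all (fun d => reached s t (src d) ==> reached s t (dst d)) A.

Lemma reachedE t x : reached s t x = (x \in s :: [seq dst d | d <- t]).
Proof. by rewrite inE. Qed.

Lemma grown_uniq t : grown t -> uniq (s :: [seq dst d | d <- t]).
Proof.
elim: t => // d t IH /= /and3P[_ + /IH /=]; rewrite reachedE !inE !negb_or.
by move=> /andP[h ->] /andP[-> ->]; rewrite eq_sym h.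
Qed.

(** If a pass adds nothing, all its darts were tested against one and the same tree, which is
    therefore closed under them. *)
Lemma bfs_round t B : {subset B <= A} -> grown t -> {subset t <= A} ->
  let t' := foldl (bfs_step s) t B in
  [/\ grown t', {subset t' <= A} & size t <= size t'] /\
  (size t' = size t -> t' = t /\
     all (fun d => reached s t (src d) ==> reached s t (dst d)) B).
Proof.
elim: B t => [|d B IH] t sB gt st //=.
have sB' : {subset B <= A} by move=> x xB; apply: sB; rewrite inE xB orbT.
have dA : d \in A by apply: sB; rewrite mem_head.
rewrite /bfs_step; case: ifP => [/andP[h1 h2]|h].
  have [] := IH (d :: t) sB'; first by rewrite /= h1 h2.
    by move=> x; rewrite inE => /predU1P[->|/st].
  move=> [g' s' le] _; split; last by move=> eq; move: le; rewrite eq /= ltnn.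
  by split=> //; apply: leq_trans le => /=.
have [h' eqs] := IH t sB' gt st; split=> // /eqs[-> ->]; split=> //.
by rewrite andbT; move: h; case: (reached s t (src d)) => //= /negbFE.
Qed.

Lemma bfs_round_closed t B :
  all (fun d => reached s t (src d) ==> reached s t (dst d)) B ->
  foldl (bfs_step s) t B = t.
Proof.
elim: B => //= d B IH /andP[/implyP h /IH].
by rewrite /bfs_step; case: ifP => // /andP[/h ->].
Qed.

Lemma bfsP : [/\ grown (bfs s A), {subset bfs s A <= A} & closed_reach (bfs s A)].
Proof.
rewrite /bfs; set f := fun t => _.
have h n : [/\ grown (iter n f [::]), {subset iter n f [::] <= A} &
    closed_reach (iter n f [::]) \/ n <= size (iter n f [::])].
  elim: n => [|n [g sA IH]]; first by split=> //; right.
  have [[g' s' le] eqs] := bfs_round (fun x h => h) g sA; split=> //.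
  rewrite iterS; case: (ltngtP (size (iter n f [::])) (size (f (iter n f [::])))).
  - move=> lt; case: IH => [cl|ge]; last by right; apply: leq_ltn_trans ge lt.
    by move: lt; rewrite /f bfs_round_closed ?ltnn.
  - by rewrite ltnNge le.
  - by move=> /esym /eqs[e cl]; left; rewrite /f e.
have [g sA [|ge]] := h (size A); first by [].
(* Here every pass added a dart: the tree consists of [size A] distinct darts of [A], hence of all
   of them, and every head is reached. *)
split=> //; apply/allP=> d dA; apply/implyP=> _; rewrite reachedE inE.
have [_ /andP[_ /map_uniq uT]] := (g, grown_uniq g).
have [_ eqA] := uniq_min_size uT sA ge.
by apply/orP; right; apply: map_f; rewrite eqA.
Qed.

(** The dart entering [y] comes before those through which its source was reached, so the rest of
    the list always contains the rest of the path. Simplicity is inherited from the newness of each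
    head. *)
Lemma trace_foldl t y acc : grown t -> reached s t y -> exists p,
  [/\ foldl trace_step (y, acc) t = (s, p ++ acc), wok s p y,
      uniq (s :: [seq dst d | d <- p]) & {subset p <= t}].
Proof.
elim: t y acc => [|d t IH] y acc.
  by rewrite reachedE inE => _ /eqP ->; exists [::]; rewrite /= eqxx.
case/and3P=> h1 h2 g hy; rewrite [foldl _ _ _]/= /trace_step.
case: ifP => [/= /eqP yd|/= ny]; last first.
  move: hy; rewrite reachedE !inE (eq_sym y (dst d)) ny /= => hy.
  have [|p [e w u st]] := IH y acc g; first by rewrite reachedE inE.
  by exists p; split=> // x /st; rewrite inE orbC => ->.
have [p [e w u st]] := IH (src d) (d :: acc) g h1.
exists (rcons p d); rewrite cat_rcons; split=> //.
- by rewrite -cats1; apply/wok_catP; exists (src d); rewrite //= yd !eqxx.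
- have nd : dst d \notin s :: [seq dst d | d <- p].
    apply: contra h2; rewrite reachedE !inE => /predU1P[->|/mapP[d' /st d't ->]].
      by rewrite eqxx.
    by apply/orP; right; apply/mapP; exists d'.
  move: nd u; rewrite /= inE negb_or map_rcons rcons_uniq mem_rcons inE negb_or.
  by case/andP=> h3 -> /andP[-> ->]; rewrite eq_sym h3.
- by move=> x; rewrite mem_rcons !inE => /predU1P[->|/st ->]; rewrite ?eqxx ?orbT.
Qed.

End Bfs.

Definition simple_path E s t (p : seq dart) :=
  [/\ {subset p <= darts E}, wok s p t & uniq (s :: [seq dst d | d <- p])].

Lemma trace_bfs E s t A : {subset A <= darts E} -> reached s (bfs s A) t ->
  simple_path E s t (trace (bfs s A) t) /\ {subset trace (bfs s A) t <= A}.
Proof.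
move=> sA; have [g st _] := bfsP s A => /(trace_foldl [::] g)[p [e w u sp]].
rewrite /trace e cats0 /=; have spA : {subset p <= A} by move=> x /sp /st.
by split=> //; split=> // x /spA /sA.
Qed.

(** An edge used twice would repeat a vertex, in whichever direction it is traversed the second
    time. *)
Lemma simple_path_uniq E s t p : simple_path E s t p -> uniq (edges p).
Proof.
case=> sE; elim: p s sE => // d p IH s sE /= /andP[/eqP ds w].
case/and3P=> ns nd u; rewrite -ds in ns *; have sE' : {subset p <= darts E}.
  by move=> x xp; apply: sE; rewrite inE xp orbT.
rewrite (IH (dst d)) ?andbT //= ?nd //; apply/mapP=> -[d' d'p e].
have := same_edge (sE _ (mem_head _ _)) (sE' _ d'p) e.
have d'm : dst d' \in [seq dst d | d <- p] by apply/mapP; exists d'.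
case=> Ed; first by rewrite Ed d'm in nd.
by move: ns; rewrite Ed inE /= d'm orbT.
Qed.

(* Conservation is stated for all vertex sets X at once: this form is additive
   in the dart list, so no vertexwise bookkeeping is needed. *)
Definition is_flow E s t n (F : seq dart) :=
  [/\ {subset F <= darts E}, uniq (edges F) &
    forall X : pred nat,
      count (fun d => X (src d)) F + n * X t =
      count (fun d => X (dst d)) F + n * X s].

Definition crossing (X : pred nat) (e : nat * nat) := X e.1 != X e.2.

Lemma count_crossing E X :
  count (crossing X) E =
  size (edges [seq d <- [seq (i, nth (0, 0) E i) | i <- iota 0 (size E)]
              | crossing X d.2]).
Proof.
rewrite /edges size_map size_filter -{1}[E](mkseq_nth (0, 0)) /mkseq !count_map.
by apply: eq_count => i.
Qed.

(** Conservation says that [X] contains [n] more tails than heads; when no dart enters [X], this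
    excess is exactly the number of darts that leave it. *)
Lemma is_flow_cut E s t n F (X : pred nat) : is_flow E s t n F ->
  X s -> ~~ X t -> (forall d, d \in F -> X (dst d) -> X (src d)) ->
  size [seq d <- F | X (src d) && ~~ X (dst d)] = n.
Proof.
move=> [_ _ /(_ X)]; rewrite size_filter => + Xs /negbTE Xt hF.
rewrite Xs Xt muln0 muln1 addn0 => h.
have h2 : count (fun d => X (src d)) F =
    count (fun d => X (dst d)) F + count (fun d => X (src d) && ~~ X (dst d)) F.
  elim: F hF {h} => //= d F IH hF.
  rewrite IH; last by move=> x xF; apply: hF; rewrite inE xF orbT.
  have := hF d (mem_head _ _); case: (X (dst d)) => [/(_ isT) ->|_] /=; first by lia.
  by case: (X _) => /=; lia.
by lia.
Qed.

Section Augment.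
Variables (E : seq (nat * nat)) (s t m : nat).
Hypothesis cut : forall X : pred nat, X s -> ~~ X t -> m <= count (crossing X) E.

(** If [t] were unreached, the reached vertices would form a cut. No flow dart enters it, as its
    reverse would be residual ([hF]), and each of its edges carries flow outwards ([out]). So the
    cut would have at most [n] edges, fewer than [m]. *)
Lemma augment_reached n F : is_flow E s t n F -> n < m ->
  reached s (bfs s (residual (darts E) F)) t.
Proof.
move=> fl lt; set A := residual _ _; set T := bfs s A.
have [_ _ /allP cl] := bfsP s A.
apply/negPn/negP=> nt; have [sF uF _] := fl.
have Rs : reached s T s by rewrite /reached eqxx.
have hF d : d \in F -> reached s T (dst d) -> reached s T (src d).
  move=> dF; apply/implyP; apply: (cl (drev d)).
  by rewrite mem_filter drevK dF orbT drev_darts sF.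
have out d : d \in darts E -> reached s T (src d) -> ~~ reached s T (dst d) ->
    d \in F.
  move=> dE r1 r2; apply/negPn/negP=> dF; case/negP: r2.
  have [|dA] := boolP (d \in A); first by move/cl; rewrite r1.
  move: dA; rewrite mem_filter dE andbT negb_or negbK => /andP[/mapP[d' d'F e]].
  have [Ed|->] := same_edge dE (sF _ d'F) e; first by rewrite Ed d'F in dF.
  by rewrite drevK d'F.
have := is_flow_cut fl Rs nt hF; have := cut Rs nt.
rewrite count_crossing; set C := edges _ => le sz.
have uC : uniq C.
  apply: (subseq_uniq (map_subseq _ (filter_subseq _ _))).
  by rewrite -map_comp map_id_in ?iota_uniq.
set F' := [seq d <- F | _] in sz.
suff /(uniq_leq_size uC) : {subset C <= edges F'}.
  by move/(leq_trans le); rewrite [size (edges F')]size_map sz leqNgt lt.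
move=> e /mapP[d].
rewrite mem_filter => /andP[cr dD] ->.
have dE : d \in darts E by rewrite /darts mem_cat dD.
move: cr; rewrite /crossing.
case r1: (reached s T (src d)); case r2: (reached s T (dst d)) => // _.
  by apply/mapP; exists d => //; rewrite mem_filter r1 r2 out ?r2.
apply/mapP; exists (drev d) => //; rewrite mem_filter /= r1 r2 /=.
by apply: out; rewrite ?drev_darts //= ?r1.
Qed.

Lemma augmentP n F : is_flow E s t n F -> n < m ->
  is_flow E s t n.+1 (augment (darts E) s t F).
Proof.
move=> fl lt; have rt := augment_reached fl lt; rewrite /augment rt.
have sA : {subset residual (darts E) F <= darts E}.
  by move=> d; rewrite mem_filter => /andP[].
have [sp pA] := trace_bfs sA rt; set p := trace _ t in sp pA *.
have up := simple_path_uniq sp; have [pE wp _] := sp; have [sF uF bal] := fl.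
split=> [d|| X].
- by rewrite mem_cat !mem_filter => /orP[] /andP[_]; [apply: sF | apply: pE].
- rewrite /edges map_cat cat_uniq; apply/and3P; split.
  + exact: (subseq_uniq (map_subseq _ (filter_subseq _ _))).
  + apply/hasPn=> e /mapP[d]; rewrite mem_filter => /andP[dF dp ->].
    apply/mapP=> -[f]; rewrite mem_filter => /andP[_ fF ef].
    have := pA _ dp; rewrite mem_filter (negbTE dF) orbF => /andP[/negP[]].
    by rewrite ef map_f.
  + exact: (subseq_uniq (map_subseq _ (filter_subseq _ _))).
- have := bal X; have := wok_count X wp; rewrite !count_cat !count_filter.
  have split_count (a b : pred dart) (r : seq dart) :
      count a r = count (predI a (fun d => ~~ b d)) r + count (predI a b) r.
    by elim: r => //= x r ->; case: (a x) => //=; case: (b x) => /=; lia.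
  (* The darts dropped from [F] and those dropped from [p] are the reverses of each other, so
     together they take the same amount from both sides of the balance. *)
  have cancel : perm_eq [seq f <- F | drev f \in p]
      (map drev [seq d <- p | drev d \in F]).
    apply: uniq_perm; first exact: filter_uniq (map_uniq uF).
      by rewrite (map_inj_uniq (can_inj drevK)) filter_uniq // (map_uniq up).
    move=> d; rewrite -{2}[d]drevK (mem_map (can_inj drevK)) !mem_filter drevK.
    by rewrite andbC.
  have c1 : count (predI (fun d => X (src d)) (fun d => drev d \in p)) F =
      count (predI (fun d => X (dst d)) (fun d => drev d \in F)) p.
    by have := permP cancel (fun d => X (src d)); rewrite count_map !count_filter.
  have c2 : count (predI (fun d => X (dst d)) (fun d => drev d \in p)) F =
      count (predI (fun d => X (src d)) (fun d => drev d \in F)) p.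
    by have := permP cancel (fun d => X (dst d)); rewrite count_map !count_filter.
  rewrite (split_count (fun d => X (src d)) (fun d => drev d \in p) F).
  rewrite (split_count (fun d => X (dst d)) (fun d => drev d \in p) F).
  rewrite (split_count (fun d => X (src d)) (fun d => drev d \in F) p).
  rewrite (split_count (fun d => X (dst d)) (fun d => drev d \in F) p).
  rewrite c1 c2 !mulSn; lia.
Qed.

Lemma flowP n : n <= m -> is_flow E s t n (flow (darts E) s t n).
Proof.
rewrite /flow; elim: n => [_|n IH lt]; first by split.
by rewrite iterS; apply: augmentP (IH (ltnW lt)) lt.
Qed.

End Augment.

Lemma peelP E (s t n : nat) (F : seq dart) Ps : s != t -> is_flow E s t n.+1 F ->
  exists p F', [/\ peel (darts E) s t (F, Ps) = (F', p :: Ps),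
    is_flow E s t n F', simple_path E s t p & perm_eq F (p ++ F')].
Proof.
move=> nst fl; have [sF uF bal] := fl; rewrite /peel /=.
set A := [seq d <- darts E | _]; set p := trace _ t; set F' := [seq f <- F | _].
have sA : {subset A <= darts E} by move=> d; rewrite mem_filter => /andP[].
have AF : {subset A <= F} by move=> d; rewrite mem_filter => /andP[].
have rt : reached s (bfs s A) t.
  have [_ _ /allP cl] := bfsP s A; apply/negPn/negP=> nt.
  have Rs : reached s (bfs s A) s by rewrite /reached eqxx.
  have hF d : d \in F -> reached s (bfs s A) (src d) -> reached s (bfs s A) (dst d).
    by move=> dF; apply/implyP/cl; rewrite mem_filter dF sF.
  (* Conservation on the unreached set: it contains [n.+1] more heads than tails, although no flow
     dart enters it. *)
  have := bal (fun x => ~~ reached s (bfs s A) x); rewrite Rs nt muln0 addn0 => e.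
  suff : count (fun d => ~~ reached s (bfs s A) (dst d)) F <=
         count (fun d => ~~ reached s (bfs s A) (src d)) F by rewrite -e; lia.
  elim: (F) hF => //= d r IH h; apply: leq_add.
    have := h d (mem_head _ _); case: (reached _ _ (src d)) => [->|_] //.
    exact: leq_b1.
  by apply: IH => x xr; apply: h; rewrite inE xr orbT.
have [sp pA] := trace_bfs sA rt; rewrite -/p in sp pA.
have up := simple_path_uniq sp; have [pE wp _] := sp.
have eF : perm_eq F (p ++ F').
  rewrite -(perm_filterC (mem p) F) perm_cat2r.
  apply: uniq_perm; [exact: filter_uniq (map_uniq uF) | exact: map_uniq up |].
  by move=> d; rewrite mem_filter; apply/andP/idP=> [[]|dp] //; rewrite AF ?pA.
exists p, F'; split=> //; split=> [d||X].
- by rewrite mem_filter => /andP[_ /sF].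
- exact: (subseq_uniq (map_subseq _ (filter_subseq _ _))).
- have cancel (a b c d x y x' y' : nat) : a + x = b + y ->
      a + c + (x + x') = b + d + (y + y') -> c + x' = d + y' by lia.
  have := bal X; rewrite !(permP eF) !count_cat !mulSn.
  exact: cancel (wok_count X wp).
Qed.

(** Each peeling lowers the value of the flow by one. What is left after [m] of them has value 0; it
    may still contain cycles, which are dropped. *)
Lemma disjoint_pathsP E (s t m : nat) : s != t ->
    (forall X : pred nat, X s -> ~~ X t -> m <= count (crossing X) E) ->
  let Ps := disjoint_paths (darts E) s t m in
  [/\ size Ps = m, uniq (edges (flatten Ps)) &
      forall P, P \in Ps -> simple_path E s t P].
Proof.
move=> nst cut /=; rewrite /disjoint_paths.
have h k : k <= m -> exists F Ps,
    [/\ iter k (peel (darts E) s t) (flow (darts E) s t m, [::]) = (F, Ps),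
        is_flow E s t (m - k) F, size Ps = k,
        uniq (edges (flatten Ps ++ F)) &
        forall P, P \in Ps -> simple_path E s t P].
  elim: k => [_|k IH lt].
    exists (flow (darts E) s t m), [::]; rewrite subn0.
    have fl := flowP cut (leqnn m); split=> //.
    by have [] := fl.
  have [F [Ps [e fl sz u sp]]] := IH (ltnW lt).
  rewrite iterS e; rewrite -(subnSK lt) in fl.
  have [p [F' [-> fl' sp' eF]]] := peelP Ps nst fl.
  exists F', (p :: Ps); split=> //=; first by rewrite sz.
    have e2 : perm_eq (flatten Ps ++ F) ((p ++ flatten Ps) ++ F').
      by rewrite -catA perm_sym perm_catCA perm_cat2l perm_sym.
    by move: u; rewrite /edges (perm_uniq (perm_map fst e2)).
  by move=> P; rewrite inE => /predU1P[->|/sp].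
have [F [Ps [-> _ sz u sp]]] := h m (leqnn m); split=> //=.
by move: u; rewrite /edges map_cat cat_uniq => /andP[].
Qed.

(** * Local search *)

Lemma adj_cat s d r : adj (s ++ d :: r) = adj (rcons s d) ++ adj (d :: r).
Proof.
rewrite /adj; elim: s => [|a [|b s] IH] //=.
by move: IH => /= ->.
Qed.

Lemma chain_wok s : s != [::] -> chain s = wok (start s) s (finish s).
Proof.
case: s => // d s _; rewrite /start /finish /= eqxx /=.
elim: s d => [|d' s IH] d /=; first by rewrite /chain /= eqxx.
by rewrite -IH /chain /adj /= eq_sym.
Qed.

Lemma wok_start x s y : s != [::] -> wok x s y -> start s = x.
Proof. by case: s => //= d s _ /andP[/eqP]. Qed.

Lemma wok_finish x s y : s != [::] -> wok x s y -> finish s = y.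
Proof.
case/lastP: s => // s d _; rewrite -cats1 => /wok_catP[z _ /=] /andP[_ /eqP <-].
by rewrite /finish cats1 last_rcons.
Qed.

Lemma otrailP u v w :
  reflect (exists a b, [/\ a \in [:: u; v], b \in [:: u; v], wok a w b,
             uniq (edges w) & odd (size w)]) (otrail u v w).
Proof.
have odd_nil (s : seq dart) : odd (size s) -> s != [::] by case: s.
apply: (iffP and5P) => [[ch uw ow sw fw]|[a [b [ha hb hw uw ow]]]].
  by exists (start w), (finish w); split=> //; rewrite -chain_wok // odd_nil.
have nw := odd_nil _ ow; split=> //.
- by rewrite chain_wok // (wok_start nw hw) (wok_finish nw hw).
- by rewrite (wok_start nw hw).
- by rewrite (wok_finish nw hw).
Qed.

Lemma otrail_wrev u v w : otrail u v w -> otrail u v (wrev w).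
Proof.
case/otrailP=> a [b [ha hb hw uw ow]]; apply/otrailP; exists b, a; split=> //.
- exact: wok_wrev.
- by rewrite edges_wrev rev_uniq.
- by rewrite size_wrev.
Qed.

Lemma edisjP s t : reflect (forall e, e \in edges s -> e \notin edges t) (edisj s t).
Proof. exact: allP. Qed.

Lemma edisj_sym s t : edisj s t = edisj t s.
Proof.
by apply/edisjP/edisjP=> h e es; apply/negP=> /h; rewrite es.
Qed.

Lemma edisj_sub s s' t t' : {subset edges s' <= edges s} ->
  {subset edges t' <= edges t} -> edisj s t -> edisj s' t'.
Proof.
by move=> ss st /edisjP h; apply/edisjP=> e /ss /h; apply: contra; apply: st.
Qed.

Lemma edges_cat s t : edges (s ++ t) = edges s ++ edges t.
Proof. exact: map_cat. Qed.

Lemma edges_wrevE s : edges (wrev s) =i edges s.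
Proof. by move=> e; rewrite edges_wrev mem_rev. Qed.

Lemma edisj_wrev s t : edisj (wrev s) t = edisj s t.
Proof. by apply: eq_all_r; apply: edges_wrevE. Qed.

Lemma uniq_edges_cat s t :
  uniq (edges (s ++ t)) = [&& uniq (edges s), edisj s t & uniq (edges t)].
Proof.
rewrite edges_cat cat_uniq; congr [&& _, _ & _].
by rewrite edisj_sym /edisj -all_predC.
Qed.

Lemma edisj_flatten s Ts : edisj s (flatten Ts) = all (edisj s) Ts.
Proof.
apply/edisjP/allP=> [h T hT|h e es].
  apply/edisjP=> e /h; apply: contra => /mapP[d dT ->]; apply: map_f.
  by apply/flattenP; exists T.
apply/mapP=> -[d /flattenP[T /h /edisjP hT dT] ed].
by move: (hT _ es); rewrite ed map_f.
Qed.

Section Family.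
Variables (E : seq (nat * nat)) (u v : nat).

Definition fam (Ts : seq (seq dart)) :=
  [/\ forall T, T \in Ts -> {subset T <= darts E},
      forall T, T \in Ts -> otrail u v T & uniq (edges (flatten Ts))].

Lemma fam_perm Ts Ts' : perm_eq Ts Ts' -> fam Ts -> fam Ts'.
Proof.
move=> eT [h1 h2 h3]; split=> [T|T|].
- by rewrite -(perm_mem eT); apply: h1.
- by rewrite -(perm_mem eT); apply: h2.
- by move: h3; rewrite /edges (perm_uniq (perm_map fst (perm_flatten eT))).
Qed.

Lemma fam_cons w Ts : fam (w :: Ts) <->
  [/\ {subset w <= darts E}, otrail u v w, all (edisj w) Ts & fam Ts].
Proof.
rewrite /fam /= uniq_edges_cat edisj_flatten; split.
  move=> [h1 h2 /and3P[h3 h4 h5]]; split=> //;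
    try by apply/h1 || apply/h2; rewrite mem_head.
  by split=> // T hT; [apply: h1 | apply: h2]; rewrite inE hT orbT.
move=> [h1 h2 h3 [h4 h5 h6]]; split=> [T|T|];
  try by rewrite inE => /predU1P[->|] //; auto.
by rewrite h3 h6; case/and5P: h2 => _ ->.
Qed.

Lemma picks_fst Ts : map fst (picks Ts) = Ts.
Proof. by rewrite -map_comp -[RHS](mkseq_nth [::]). Qed.

Lemma mem_fst_picks (T : seq dart) Ts : T \in Ts ->
  exists2 p, p \in picks Ts & p.1 = T.
Proof. by rewrite -{1}(picks_fst Ts) => /mapP[p hp ->]; exists p. Qed.

Lemma breaks_le_size Qs w : breaks Qs w <= size w.
Proof.
by apply: leq_trans (count_size _ _) _; rewrite /adj size_zip geq_minl.
Qed.

Section Reduce.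
Variable Qs : seq (seq dart).
Hypothesis QE : forall Q, Q \in Qs -> {subset Q <= darts E}.

Lemma splices_sub T Q w : Q \in Qs -> {subset T <= darts E} ->
  w \in splices T Q -> {subset w <= darts E}.
Proof.
move=> /QE sQ sT /mem_splices[i [j [T' [hT ->]]]] d.
rewrite mem_cat => /orP[/mem_take/sQ //|/mem_drop]; move: hT.
by rewrite mem_seq2 => /pred2P[] ->; rewrite ?mem_wrev => /sT //; rewrite drev_darts.
Qed.

Definition total Ts := \sum_(T <- Ts) breaks Qs T.

Lemma improve_fam Ts : fam Ts ->
  [/\ fam (improve u v Qs Ts), size (improve u v Qs Ts) = size Ts &
      improvements u v Qs Ts = [::] \/
      total (improve u v Qs Ts) < total Ts].
Proof.
move=> fT; case: (improveP u v Qs Ts) => [[-> h]|]; first by split=> //; left.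
move=> [p [Q [w [hp hQ hw /and3P[ow dw lt] ->]]]]; have ep := mem_picks hp.
have /fam_cons[s1 _ _ f2] := fam_perm ep fT; split.
- by apply/fam_cons; split=> //; apply: splices_sub hw.
- by rewrite (perm_size ep).
- by right; rewrite /total (perm_big _ ep) !big_cons ltn_add2r.
Qed.

Lemma improve_id Ts :
  improvements u v Qs Ts = [::] -> improve u v Qs Ts = Ts.
Proof. by rewrite /improve => ->. Qed.

Lemma reduceP Ts : fam Ts ->
  [/\ fam (reduce u v Qs Ts), size (reduce u v Qs Ts) = size Ts &
      improvements u v Qs (reduce u v Qs Ts) = [::]].
Proof.
move=> fT; rewrite /reduce; set n := size (flatten Ts).
have h k : let Ts' := iter k (improve u v Qs) Ts in
    [/\ fam Ts', size Ts' = size Ts &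
      improvements u v Qs Ts' = [::] \/ total Ts' + k <= total Ts].
  elim: k => [|k [f sz IH]]; first by split=> //; right; rewrite addn0.
  have [f' sz' d] := improve_fam f; split=> //=; first by rewrite sz'.
  case: IH => [e|le]; first by left; rewrite improve_id.
  case: d => [e|lt]; first by left; rewrite improve_id.
  by right; rewrite addnS (leq_trans _ le) // -addSn leq_add2r.
have [f sz [//|le]] := h n; split=> //.
have le0 : total Ts <= n.
  rewrite /total /n size_flatten sumnE big_map.
  by apply: leq_sum => T _; apply: breaks_le_size.
(* After [n] effective rounds no break is left, and a further improvement would need a trail that
   has one. *)
have t0 : total (iter n (improve u v Qs) Ts) = 0 by lia.
case e: (improvements _ _ _ _) => [|T' r] //.
have : T' \in improvements u v Qs (iter n (improve u v Qs) Ts) by rewrite e mem_head.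
case/mem_improvements=> p [Q [w [hp _ _ /and3P[_ _ lt] _]]].
by move: t0 lt; rewrite /total (perm_big _ (mem_picks hp)) big_cons /=; lia.
Qed.

End Reduce.
End Family.

Lemma adjP (s : seq dart) (c d : dart) :
  reflect (exists l r, s = l ++ c :: d :: r) ((c, d) \in adj s).
Proof.
apply: (iffP idP) => [|[l [r ->]]]; last by rewrite adj_cat mem_cat mem_head orbT.
elim: s => [|a [|b s] IH] //=; rewrite inE.
case/predU1P=> [[-> ->]|/IH[l [r e]]]; first by exists [::], s.
by exists (a :: l), r; rewrite e.
Qed.

Lemma flatten_edge_inj Ts T T' e : uniq (edges (flatten Ts)) ->
  T \in Ts -> T' \in Ts -> e \in edges T -> e \in edges T' -> T = T'.
Proof.
elim: Ts => //= S Ts IH; rewrite uniq_edges_cat edisj_flatten.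
case/and3P=> _ /allP dS uT; rewrite !inE.
case/predU1P=> [->|hT] /predU1P[->|hT'] // eT eT'; last exact: IH eT eT'.
  by move: (edisjP _ _ (dS _ hT') _ eT); rewrite eT'.
by move: (edisjP _ _ (dS _ hT) _ eT'); rewrite eT.
Qed.

Lemma wok_wrev_vertices x s y : wok x s y ->
  y :: [seq dst d | d <- wrev s] = rev (x :: [seq dst d | d <- s]).
Proof.
elim: s x => [|d s IH] x /=; first by move/eqP->.
case/andP=> /eqP <- /IH e; by rewrite rev_cons /= -e /wrev /= rev_cons map_rcons.
Qed.

Lemma simple_path_wrev E x y P :
  simple_path E x y P -> simple_path E y x (wrev P).
Proof.
case=> sE w un; split; last by rewrite (wok_wrev_vertices w) rev_uniq.
  by move=> d; rewrite mem_wrev -(drev_darts E) => /sE.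
exact: wok_wrev.
Qed.

Lemma simple_path_noloop E x y P d :
  simple_path E x y P -> d \in P -> src d != dst d.
Proof.
case=> _ w un dP; case/splitPr: P / dP w un => l r w un; move: w.
case/wok_catP=> z /wok_last <- /= /andP[/eqP -> _].
move: un; rewrite map_cat -cat_cons cat_uniq => /and3P[_ /hasPn n1 _].
by apply: contraNneq (n1 (dst d) (mem_head _ _)) => <-; apply: mem_last.
Qed.

Lemma uniq_edges_inj (s : seq dart) d d' :
  uniq (edges s) -> d \in s -> d' \in s -> d.1 = d'.1 -> d = d'.
Proof.
elim: s => //= a s IH /andP[na us]; rewrite !inE.
case/predU1P=> [->|ds] /predU1P[->|ds'] // e; last exact: IH.
  by move: na; rewrite e map_f.
by move: na; rewrite -e map_f.
Qed.

(** A simple path visits its two ends only at its extremities. Trails end in the same two vertices,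
    so a trail whose first dart lies on a path in the same direction starts with the first dart of
    that path. *)
Lemma simple_path_start E a b l d r : simple_path E a b (l ++ d :: r) ->
  src d = a \/ src d = b -> l = [::].
Proof.
case=> _ + un; move=> /wok_catP[z wl /= /andP[/eqP dz wr]]; rewrite dz.
move: un; rewrite map_cat -cat_cons cat_uniq => /and3P[u1 /hasPn n1 _].
have zl : z \in a :: [seq dst x | x <- l] by rewrite -(wok_last wl) mem_last.
case=> [za|zb]; last first.
  have : b \in dst d :: [seq dst x | x <- r] by rewrite -(wok_last wr) mem_last.
  by move/n1; rewrite -zb zl.
case/lastP: l wl u1 {n1 zl} => // l c wl /= /andP[]; rewrite -za -(wok_last wl).
by rewrite map_rcons last_rcons mem_rcons mem_head.
Qed.

(** The counterpart at the far extremity: a part of the path that stops at one of the two end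
    vertices has nothing after it. *)
Lemma simple_path_end E a b x l r f : simple_path E a b (l ++ r) -> l != [::] ->
  wok x l f -> f = a \/ f = b -> r = [::].
Proof.
case: r => // e r sp nl wl fab.
case: l nl wl sp => // d l _ wl sp; have [_ /= /andP[/eqP da wlr] _] := sp.
have := simple_path_start sp; rewrite -[d :: l]/([:: d] ++ l).
move: wl => /= /andP[_ wl]; move/wok_catP: wlr => [z wz /= /andP[/eqP ez _]].
by rewrite ez -(wok_last wz) (wok_last wl) => /(_ fab).
Qed.

Lemma uniq_split (T : eqType) (l l' r r' : seq T) d : uniq (l ++ d :: r) ->
  l ++ d :: r = l' ++ d :: r' -> l = l' /\ r = r'.
Proof.
elim: l l' => [|a l IH] [|a' l'] //=.
- by move=> _ [->].
- by case/andP=> h _ [e1 e2]; move: h; rewrite e2 -e1 mem_cat mem_head orbT.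
- by case/andP=> h _ [e1 e2]; move: h; rewrite e1 mem_cat mem_head orbT.
- by case/andP=> _ u [-> /(IH _ u)[-> ->]].
Qed.

Lemma adj_wrev s : adj (wrev s) = rev [seq (drev p.2, drev p.1) | p <- adj s].
Proof.
elim: s => // c [|d s] // IH.
rewrite -[adj [:: c, d & s]]/((c, d) :: adj (d :: s)) map_cons rev_cons -IH.
rewrite /wrev /= !rev_cons.
by rewrite -[rcons (rcons _ _) _]cats1 cat_rcons adj_cat cats1.
Qed.

(** * Paths against a family of trails that admits no improvement *)

Section Structure.
Variables (E : seq (nat * nat)) (u v : nat) (Ps : seq (seq dart)).
Hypothesis sp : forall P, P \in Ps -> simple_path E v u P.
Hypothesis up : uniq (edges (flatten Ps)).

Let Qs := Ps ++ map wrev Ps.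

Lemma mem_Qs Q : Q \in Qs -> exists2 P, P \in Ps & Q = P \/ Q = wrev P.
Proof.
rewrite mem_cat => /orP[QP|/mapP[P PP ->]]; first by exists Q => //; left.
by exists P => //; right.
Qed.

Lemma wrev_Qs Q : Q \in Qs -> wrev Q \in Qs.
Proof.
case/mem_Qs=> P PP [] ->; rewrite mem_cat ?wrevK ?PP //.
by rewrite map_f ?orbT.
Qed.

Lemma Qs_simple Q : Q \in Qs -> exists a b,
  [/\ simple_path E a b Q, a \in [:: u; v] &
      forall x, x \in [:: u; v] -> x = a \/ x = b].
Proof.
case/mem_Qs=> P /sp sP [] ->.
  exists v, u; split; rewrite ?mem_seq2 ?eqxx ?orbT // => x.
  by rewrite mem_seq2 => /pred2P[]; auto.
exists u, v; split; rewrite ?mem_seq2 ?eqxx ?orbT //.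
  exact: simple_path_wrev.
by move=> x; rewrite mem_seq2 => /pred2P[]; auto.
Qed.

Lemma Qs_sub Q : Q \in Qs -> {subset Q <= darts E}.
Proof. by case/Qs_simple=> a [b [[]]]. Qed.

Lemma Qs_edges Q Q' e : Q \in Qs -> Q' \in Qs -> e \in edges Q -> e \in edges Q' ->
  Q = Q' \/ Q = wrev Q'.
Proof.
move=> /mem_Qs[P PP eQ] /mem_Qs[P' PP' eQ'] eE eE'.
have : P = P'.
  apply: (flatten_edge_inj up PP PP' (e := e)).
    by case: eQ eE => ->; rewrite ?edges_wrevE.
  by case: eQ' eE' => ->; rewrite ?edges_wrevE.
by move=> Ee; move: eQ eQ'; rewrite -Ee => -[] -> [] ->; rewrite ?wrevK; auto.
Qed.

(** A dart determines its path together with the orientation: a simple path containing [d] and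
    [drev d] would use an edge twice unless [d] were its own reverse, which means a loop. *)
Lemma Qs_dart Q Q' d : Q \in Qs -> Q' \in Qs -> d \in Q -> d \in Q' -> Q = Q'.
Proof.
move=> hQ hQ' dQ dQ'.
have [//|e] := Qs_edges hQ hQ' (map_f fst dQ) (map_f fst dQ').
have [a [b [sQ _ _]]] := Qs_simple hQ.
have dr : drev d \in Q by rewrite e mem_wrev drevK.
have ed := uniq_edges_inj (simple_path_uniq sQ) dr dQ erefl.
by have := simple_path_noloop sQ dQ; rewrite -{1}ed eqxx.
Qed.

Definition consecutive p := has (fun Q => p \in adj Q) Qs.

Lemma consecutive_drev c d : consecutive (drev d, drev c) = consecutive (c, d).
Proof.
have h c' d' : consecutive (c', d') -> consecutive (drev d', drev c').
  case/hasP=> Q hQ hcd; apply/hasP; exists (wrev Q); first exact: wrev_Qs.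
  by rewrite adj_wrev mem_rev; apply/mapP; exists (c', d').
by apply/idP/idP=> /h; rewrite ?drevK.
Qed.

Lemma breaks_cat s d r :
  breaks Qs (s ++ d :: r) = breaks Qs (rcons s d) + breaks Qs (d :: r).
Proof. by rewrite /breaks adj_cat count_cat. Qed.

Lemma breaks_rcons s c d :
  breaks Qs (rcons (rcons s c) d) = breaks Qs (rcons s c) + ~~ consecutive (c, d).
Proof.
by rewrite -[rcons (rcons _ _) _]cats1 cat_rcons breaks_cat /breaks /= addn0.
Qed.

Lemma breaks_wrev s : breaks Qs (wrev s) = breaks Qs s.
Proof.
rewrite /breaks adj_wrev count_rev count_map; apply: eq_count => -[c d] /=.
by rewrite -/(consecutive _) consecutive_drev.
Qed.

Lemma breaks_prefix A B : A ++ B \in Qs -> breaks Qs A = 0.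
Proof.
move=> hQ; apply/eqP; rewrite -leqn0 leqNgt -has_count; apply/hasPn=> -[c d].
case/adjP=> l [r eA]; rewrite negbK; apply/hasP; exists (A ++ B) => //.
by apply/adjP; exists l, (r ++ B); rewrite eA -catA.
Qed.

Lemma Qs_uniq Q : Q \in Qs -> uniq Q.
Proof. by case/Qs_simple=> a [b [/simple_path_uniq /map_uniq]]. Qed.

(** The paths are edge-disjoint, so after [d] only the next dart of its own path avoids a break. *)
Lemma consecutive_next A d B c :
  A ++ d :: B \in Qs -> consecutive (d, c) -> exists B', B = c :: B'.
Proof.
move=> hQ /hasP[Q' hQ' /adjP[l [r e]]].
have eQ : A ++ d :: B = Q'.
  by apply: (Qs_dart hQ hQ' (d := d)); rewrite ?e mem_cat mem_head orbT.
have [_ ->] := uniq_split (Qs_uniq hQ) (etrans eQ e).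
by exists r.
Qed.

Lemma consecutive_prev A d B c :
  A ++ d :: B \in Qs -> consecutive (c, d) -> exists A', A = rcons A' c.
Proof.
move=> hQ /hasP[Q' hQ' /adjP[l [r e]]].
have eQ : A ++ d :: B = Q'.
  by apply: (Qs_dart hQ hQ' (d := d)); rewrite ?e mem_cat ?inE eqxx ?orbT.
rewrite -cat_rcons in e.
have [-> _] := uniq_split (Qs_uniq hQ) (etrans eQ e).
by exists l.
Qed.

(** Without breaks, the walk is forced at each dart to stay on the path of [d]. *)
Lemma breaks0_prefix A d B R : A ++ d :: B \in Qs -> breaks Qs (d :: R) = 0 ->
  exists B', B = R ++ B'.
Proof.
elim: R A d B => [|c R IH] A d B hQ; first by exists B.
rewrite -[d :: c :: R]/([:: d] ++ c :: R) breaks_cat.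
rewrite -[rcons _ _]/(rcons (rcons [::] d) c) breaks_rcons => /eqP.
rewrite !addn_eq0 eqb0 negbK => /andP[/andP[_ hr] /eqP b0].
have [B' eB] := consecutive_next hQ hr; rewrite eB -cat_rcons in hQ.
by have [B2 e] := IH _ _ _ hQ b0; exists B2; rewrite eB e.
Qed.

Variable Ts : seq (seq dart).
Hypotheses (fT : fam E u v Ts) (stuck : improvements u v Qs Ts = [::]).

(** Stuckness in the form in which it is used. The splice [A ++ R] stays disjoint from the other
    trails because [A] meets no trail at all and the edges of [R] belong to the trail being
    replaced. *)
Lemma no_improvement p Q A B T' L R : p \in picks Ts -> Q \in Qs -> Q = A ++ B ->
  T' \in [:: p.1; wrev p.1] -> T' = L ++ R -> edisj A (flatten Ts) ->
  otrail u v (A ++ R) -> breaks Qs T' <= breaks Qs (A ++ R).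
Proof.
move=> hp hQ eQ hT' eT' dA ow; rewrite leqNgt; apply/negP=> lt.
have [_ _ uT] := fam_perm (mem_picks hp) fT.
suff : (A ++ R) :: p.2 \in improvements u v Qs Ts by rewrite stuck.
apply/mem_improvements; exists p, Q, (A ++ R); split=> //.
  apply/mem_splices; exists (size A), (size L), T'; split=> //.
  by rewrite eQ eT' take_size_cat // drop_size_cat.
apply/and3P; split=> //; last first.
  suff <- : breaks Qs T' = breaks Qs p.1 by [].
  by move: hT'; rewrite mem_seq2 => /pred2P[] ->; rewrite ?breaks_wrev.
apply/allP=> S hS; move: uT; rewrite /= uniq_edges_cat edisj_flatten.
case/and3P=> _ /allP/(_ _ hS) dS _.
rewrite /edisj edges_cat all_cat; apply/andP; split.
  move: dA; rewrite edisj_flatten => /allP; apply.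
  by rewrite (perm_mem (mem_picks hp)) inE hS orbT.
apply: edisj_sub dS => // e eR.
have : e \in edges T' by rewrite eT' edges_cat mem_cat eR orbT.
by move: hT'; rewrite mem_seq2 => /pred2P[] ->; rewrite ?edges_wrevE.
Qed.

(** [A] grows along [Q] until the next edge belongs to a trail; [T'] is that trail, oriented so as
    to traverse this edge in the direction of [Q]. *)
Lemma first_contact Q : Q \in Qs -> ~~ all (edisj Q) Ts -> exists A d B p T' L R,
  [/\ Q = A ++ d :: B, edisj A (flatten Ts), p \in picks Ts,
      T' \in [:: p.1; wrev p.1] & T' = L ++ d :: R].
Proof.
rewrite -edisj_flatten => hQ.
have [sQ [sT _ _]] := (Qs_sub hQ, fT).
have : exists A B, Q = A ++ B /\ edisj A (flatten Ts) by exists [::], Q.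
case=> A [B [eQ]]; elim: B A eQ => [|d B IH] A eQ dA; first by rewrite eQ cats0 dA.
have [dT _|dT] := boolP (d.1 \in edges (flatten Ts)); last first.
  apply: (IH (rcons A d)); first by rewrite cat_rcons.
  by rewrite /edisj /edges map_rcons all_rcons /= dT.
case/mapP: dT => d' /flattenP[T hT d'T] e.
have [p hp eT] := mem_fst_picks hT.
have dE : d \in darts E by apply: sQ; rewrite eQ mem_cat mem_head orbT.
have [T' hT' dT'] : exists2 T', T' \in [:: p.1; wrev p.1] & d \in T'.
  rewrite eT; have [->|->] := same_edge dE (sT _ hT _ d'T) e.
    by exists T; rewrite ?mem_head.
  by exists (wrev T); rewrite ?mem_seq2 ?eqxx ?orbT // mem_wrev drevK.
case/splitPr: T' / dT' hT' => L R hT'.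
by exists A, d, B, p, (L ++ d :: R), L, R.
Qed.

(** The two ends of [s], each recorded as the dart that leaves it. Ends of trails are compared with
    extremities of paths as darts, since as vertices they are all [u] or [v]. *)
Definition heads (s : seq dart) :=
  [:: head (0, (0, 0)) s; head (0, (0, 0)) (wrev s)].

(** The first alternative charges the near extremity of [Q] to a trail end; the far one is charged
    instead only if no other trail meets [Q]. Applied to a path and to its reverse, this charges
    both extremities of a path met by several trails. *)
Lemma hosting Q : Q \in Qs -> ~~ all (edisj Q) Ts -> exists2 p, p \in picks Ts &
  ~~ edisj Q p.1 /\
  (head (0, (0, 0)) Q \in heads p.1 \/
   head (0, (0, 0)) (wrev Q) \in heads p.1 /\ all (edisj Q) p.2).
Proof.
move=> hQ /(first_contact hQ)[A [d [B [p [T' [L [R [eQ dA hp hT' eT']]]]]]]].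
exists p => //.
have hT : p.1 \in Ts by rewrite (perm_mem (mem_picks hp)) mem_head.
have eT'E : edges T' =i edges p.1.
  by move: hT'; rewrite mem_seq2 => /pred2P[] -> // e; rewrite edges_wrevE.
have hT'w : wrev T' \in [:: p.1; wrev p.1].
  by move: hT'; rewrite !mem_seq2 => /pred2P[] ->; rewrite ?wrevK eqxx ?orbT.
have head_mem (s : seq dart) : s \in [:: p.1; wrev p.1] ->
    head (0, (0, 0)) s \in heads p.1.
  by rewrite !mem_seq2 => /pred2P[] ->; rewrite eqxx ?orbT.
split.
  apply/negP=> /edisjP /(_ d.1); rewrite -eT'E eQ eT' !edges_cat !mem_cat /=.
  by rewrite !mem_head !orbT => /(_ isT).
have oT' : otrail u v T'.
  have [_ h _] := fT; move: hT'; rewrite mem_seq2 => /pred2P[] ->; first exact: h.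
  by apply: otrail_wrev; apply: h.
have [a [b [sQ ha hab]]] := Qs_simple hQ.
have [sE wQ unQ] := sQ; rewrite {}eQ in hQ sQ sE wQ unQ *.
have [y wA /= /andP[/eqP dy _]] := wok_catP _ _ _ _ wQ.
have [x [z [hx hz wT' uT' oddT']]] := otrailP _ _ _ oT'.
rewrite {}eT' in hT' hT'w eT'E oT' wT' uT' oddT' *.
have [y' wL /= /andP[/eqP dy' wR]] := wok_catP _ _ _ _ wT'.
have uA : uniq (edges A).
  by move: (simple_path_uniq sQ); rewrite uniq_edges_cat => /andP[].
have dAT' : edisj A (L ++ d :: R).
  move: dA; rewrite edisj_flatten => /allP/(_ _ hT).
  by apply: edisj_sub => // e; rewrite eT'E.
(* The trail turns onto [Q] at [d]: had it come along [Q], the preceding dart [c] would be the last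
   of [A], which shares no edge with a trail. *)
have nocons c L0 : L = rcons L0 c -> ~~ consecutive (c, d).
  move=> eL; apply/negP=> /(consecutive_prev hQ)[A' eA].
  move: dAT'; rewrite eA eL => /edisjP/(_ c.1).
  rewrite !edges_cat !mem_cat /edges !map_rcons !mem_rcons !mem_head /=.
  by move/(_ isT).
(* A trail that starts with [d] starts at [u] or [v], and [Q] leaves such a vertex only by its first
   dart. *)
have nilA : L = [::] -> A = [::].
  move=> eL; apply: (simple_path_start sQ).
  by apply: hab; move: wT'; rewrite eL /= => /andP[/eqP ->].
(* If A ++ d :: R is odd, it lacks the break between L and d, so L is empty. *)
have [oddA|oddB] := boolP (odd (size (A ++ d :: R))).
  have oA : otrail u v (A ++ d :: R).
    apply/otrailP; exists a, z; split=> //.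
      by apply/wok_catP; exists y; rewrite //= dy eqxx.
    move: uT'; rewrite !uniq_edges_cat uA => /and3P[_ _ ->]; rewrite andbT.
    by apply: edisj_sub dAT' => // e; rewrite edges_cat mem_cat orbC => ->.
  have := no_improvement hp hQ erefl hT' erefl dA oA.
  rewrite !breaks_cat leq_add2r (breaks_prefix (A := rcons A d) (B := B)) ?cat_rcons //.
  case/lastP EL : L => [|L0 c] => [_|]; last first.
    by rewrite breaks_rcons (nocons _ _ EL) addn1.
  left; rewrite (nilA EL) /=; move: hT'; rewrite EL => /head_mem //.
(* Otherwise A ++ wrev L is odd; it trades the break before d and those of
   d :: R for at most one new break, so d :: R runs along Q up to its end. *)
have oddB' : odd (size (A ++ wrev L)).
  move: oddB oddT'; rewrite !size_cat size_wrev /= !oddD /=.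
  by case: (odd (size A)); case: (odd (size L)); case: (odd (size R)).
have oB : otrail u v (A ++ wrev L).
  apply/otrailP; exists a, x; split=> //.
    by apply/wok_catP; exists y => //; rewrite -dy dy'; apply: wok_wrev.
  rewrite uniq_edges_cat uA edges_wrev rev_uniq.
  move: uT'; rewrite uniq_edges_cat => /andP[-> _]; rewrite andbT.
  rewrite edisj_sym edisj_wrev edisj_sym; apply: edisj_sub dAT' => // e.
  by rewrite edges_cat mem_cat => ->.
have wcat (s t : seq dart) : wrev (s ++ t) = wrev t ++ wrev s.
  by rewrite /wrev map_cat rev_cat.
have := no_improvement hp hQ erefl hT'w (wcat _ _) dA oB; rewrite breaks_wrev.
case/lastP EL : L => [|L0 c].
  by rewrite (nilA EL) EL in oddB'.
rewrite breaks_cat breaks_rcons (nocons _ _ EL) -cats1 wcat /= => le.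
(* Reversing [L] keeps its breaks; the junction adds at most one, and none if [A] is empty. *)
have le2 : breaks Qs (A ++ drev c :: wrev L0) <= breaks Qs (L0 ++ [:: c]) + (A != [::]).
  rewrite -[breaks Qs (L0 ++ _)]breaks_wrev wcat.
  case/lastP: (A) (breaks_prefix hQ) => [|A0 a0] b0; first by rewrite addn0.
  rewrite breaks_cat breaks_rcons b0 addnC leq_add2l.
  by rewrite -cats1; case: (A0) => //= *; apply: leq_b1.
have := leq_trans le le2; rewrite -addnA leq_add2l add1n => le3.
(* [le3] has at least 1 on its left and at most 1 on its right, so there is a junction and no break
   in [d :: R]. *)
have nA : A != [::] by case: (A != [::]) le3.
have b0 : breaks Qs (d :: R) = 0 by move: le3; rewrite nA; case: (breaks _ _).
have [B' eB] := breaks0_prefix hQ b0.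
(* [A ++ d :: R] is a part of [Q] that starts where [Q] does and stops at an end of the trail, that
   is at [u] or [v]; so it is all of [Q]. *)
have eB' : B' = [::].
  apply: (simple_path_end (E := E) (a := a) (b := b) (x := a)
    (l := A ++ d :: R) (f := z)).
  - by rewrite -catA /= -eB.
  - by case: (A).
  - by apply/wok_catP; exists y; rewrite //= dy eqxx.
  - exact: hab.
rewrite eB' cats0 in eB; rewrite eB; right; split.
  have -> : head (0, (0, 0)) (wrev (A ++ d :: R)) =
      head (0, (0, 0)) (wrev (L ++ d :: R)).
    by rewrite !wcat; case: (wrev (d :: R)) (size_wrev (d :: R)).
  exact: head_mem.
apply/allP=> S hS; rewrite /edisj edges_cat all_cat; apply/andP; split.
  move: dA; rewrite edisj_flatten => /allP; apply.
  by rewrite (perm_mem (mem_picks hp)) inE hS orbT.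
have [_ _] := fam_perm (mem_picks hp) fT; rewrite /= uniq_edges_cat edisj_flatten.
case/and3P=> _ /allP/(_ _ hS) dS _.
apply: (@edisj_sub p.1 (d :: R) S S) dS => // e eR.
by rewrite -eT'E edges_cat mem_cat eR orbT.
Qed.
End Structure.

(** * Counting trail ends *)

Lemma head_in (s : seq dart) : s != [::] -> head (0, (0, 0)) s \in s.
Proof. by case: s => // d s _; rewrite mem_head. Qed.

Lemma wrev_nil (s : seq dart) : (wrev s == [::]) = (s == [::]).
Proof. by rewrite -!size_eq0 size_wrev. Qed.

Lemma simple_path_nil E x y P : x != y -> simple_path E x y P -> P != [::].
Proof. by move=> xy [_ + _]; case: P => //= /eqP e; rewrite e eqxx in xy. Qed.

(** Across paths this is edge-disjointness; within one path, the two darts could agree only if a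
    dart were its own reverse, that is a loop. *)
Lemma uniq_heads E x y (Ps : seq (seq dart)) : x != y ->
    (forall P, P \in Ps -> simple_path E x y P) -> uniq (edges (flatten Ps)) ->
  uniq (flatten [seq heads P | P <- Ps]).
Proof.
move=> xy; elim: Ps => // P Ps IH sp.
have sP := sp P (mem_head _ _).
have sp' Q : Q \in Ps -> simple_path E x y Q.
  by move=> h; apply: sp; rewrite inE h orbT.
have heads_sub Q d : Q != [::] -> d \in heads Q -> d.1 \in edges Q.
  move=> nQ; rewrite mem_seq2 => /pred2P[] ->; first exact/map_f/head_in.
  by rewrite -edges_wrevE; apply/map_f/head_in; rewrite wrev_nil.
have nP := simple_path_nil xy sP.
rewrite [flatten _]/= uniq_edges_cat edisj_flatten => /and3P[uP /allP dP uPs].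
rewrite map_cons -[flatten _]/(heads P ++ flatten [seq heads Q | Q <- Ps]) cat_uniq.
rewrite (IH sp' uPs) andbT; apply/andP; split.
  rewrite /= andbT inE; apply/eqP=> e.
  have h1 := head_in nP; have : head (0, (0, 0)) (wrev P) \in wrev P.
    by apply: head_in; rewrite wrev_nil.
  rewrite -e mem_wrev => h2; have ed := uniq_edges_inj uP h2 h1 erefl.
  by have := simple_path_noloop sP h1; rewrite -{1}ed eqxx.
apply/hasPn=> d /flattenP[_ /mapP[Q hQ ->] dQ]; apply/negP=> dP'.
have := edisjP _ _ (dP _ hQ) _ (heads_sub _ _ nP dP').
by rewrite (heads_sub Q) // (simple_path_nil xy (sp' _ hQ)).
Qed.

(** Charging: at least [c P] extremities of each [P] occur in [H], and distinct extremities use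
    distinct items of [H]. *)
Lemma leq_count_flatten (H : seq dart) (Ps : seq (seq dart)) (c : seq dart -> nat) :
    uniq (flatten [seq heads P | P <- Ps]) ->
    (forall P, P \in Ps -> c P <= count (mem H) (heads P)) ->
  \sum_(P <- Ps) c P <= size H.
Proof.
move=> un hc; apply: (@leq_trans (count (mem H) (flatten [seq heads P | P <- Ps]))).
  rewrite count_flatten sumnE !big_map big_seq [leqRHS]big_seq.
  exact: leq_sum.
rewrite -size_filter; apply: uniq_leq_size; first exact: filter_uniq.
by move=> d; rewrite mem_filter => /andP[].
Qed.

Section Counting.
Variables (E : seq (nat * nat)) (u v : nat) (Ps Ts : seq (seq dart)).
Hypotheses (uv : u != v) (sp : forall P, P \in Ps -> simple_path E v u P).
Hypotheses (up : uniq (edges (flatten Ps))) (szP : size Ps = size Ts + size Ts).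
Hypothesis fT : fam E u v Ts.
Hypothesis stuck : improvements u v (Ps ++ map wrev Ps) Ts = [::].

Lemma picks_others p T : p \in picks Ts -> T \in Ts -> T = p.1 \/ T \in p.2.
Proof. by move=> hp; rewrite (perm_mem (mem_picks hp)) => /predU1P. Qed.

Definition owner P (p : seq dart * seq (seq dart)) :=
  ~~ edisj P p.1 && all (edisj P) p.2.

Lemma owner_unique P p p' : p \in picks Ts -> p' \in picks Ts ->
  owner P p -> ~~ edisj P p'.1 -> p'.1 = p.1.
Proof.
move=> hp hp' /andP[_ /allP h] n; have hT : p'.1 \in Ts.
  by rewrite (perm_mem (mem_picks hp')) mem_head.
by have [//|/h] := picks_others hp hT; rewrite (negbTE n).
Qed.

(* A path met by two trails has a trail end at both extremities, a path met by
   one trail at one of them at least; there are as many trail ends as paths. *)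
Lemma few_unserved :
  count (fun p => ~~ served Ps p) (picks Ts) <= size (untouched Ps Ts).
Proof.
have vu : v != u by rewrite eq_sym.
have uH := uniq_heads vu sp up.
pose c0 P := all (edisj P) Ts.
pose c1 P := ~~ c0 P && has (owner P) (picks Ts).
pose c2 P := ~~ c0 P && ~~ c1 P.
pose nice (p : seq dart * seq (seq dart)) := ~~ nilp (private Ps p).
pose H := flatten [seq heads T | T <- Ts].
pose Hg := flatten [seq heads p.1 | p <- picks Ts & nice p].
have sz (A : Type) (f : A -> seq dart) s :
    size (flatten [seq heads (f x) | x <- s]) = size s + size s.
  by elim: s => //= x s ->; rewrite addnS.
have hostP P : P \in Ps -> ~~ c0 P -> exists2 p, p \in picks Ts & ~~ edisj P p.1 /\
    (head (0, (0, 0)) P \in heads p.1 \/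
     head (0, (0, 0)) (wrev P) \in heads p.1 /\ owner P p).
  move=> hP n0; have [|p hp [n h]] := hosting sp up fT stuck _ n0.
    by rewrite mem_cat hP.
  exists p => //; split=> //; case: h => [h|[h a]]; [by left | right].
  by rewrite /owner n.
have hostW P : P \in Ps -> ~~ c0 P -> exists2 p, p \in picks Ts & ~~ edisj P p.1 /\
    (head (0, (0, 0)) (wrev P) \in heads p.1 \/
     head (0, (0, 0)) P \in heads p.1 /\ owner P p).
  move=> hP n0; have [||p hp [n h]] := hosting sp up fT stuck (Q := wrev P).
  - by rewrite mem_cat map_f ?orbT.
  - by rewrite (eq_all (edisj_wrev P)).
  rewrite edisj_wrev wrevK (eq_all (edisj_wrev P)) in n h.
  exists p => //; split=> //; case: h => [h|[h a]]; [by left | right].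
  by rewrite /owner n.
have inH p d : p \in picks Ts -> d \in heads p.1 -> d \in H.
  move=> hp hd; apply/flattenP; exists (heads p.1) => //; apply: map_f.
  by rewrite (perm_mem (mem_picks hp)) mem_head.
(* A path with an owner uses one of the trail ends. A met path without an owner uses two, since the
   second alternative of [hosting] would provide an owner. *)
have le1 : \sum_(P <- Ps) (c1 P + 2 * c2 P) <= size Ts + size Ts.
  rewrite -(sz _ id); apply: (leq_count_flatten uH) => P hP /=; rewrite addn0.
  have [n0|] := boolP (~~ c0 P); last by rewrite /c2 /c1 => /negbTE ->.
  have [p hp [n h]] := hostP P hP n0; have [p' hp' [n' h']] := hostW P hP n0.
  have [k1|k1] := boolP (c1 P).
    rewrite /c2 k1 andbF /=; case: h => [/(inH _ _ hp) ->|[/(inH _ _ hp) -> _]] //.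
    by rewrite addn1.
  have no q : q \in picks Ts -> ~~ owner P q.
    move=> hq; apply: contra k1 => o; rewrite /c1 n0; apply/hasP; by exists q.
  rewrite /c2 k1 n0 /=.
  case: h => [/(inH _ _ hp) ->|[_ o]]; last by case/negP: (no _ hp).
  by case: h' => [/(inH _ _ hp') ->|[_ o]]; last by case/negP: (no _ hp').
(* Only its owner meets such a path, so the end charged to it is an end of a trail that has a
   private path. *)
have le2 : \sum_(P <- Ps) c1 P <= count nice (picks Ts) + count nice (picks Ts).
  rewrite -size_filter -(sz _ fst); apply: (leq_count_flatten uH) => P hP.
  have [k1|//] := boolP (c1 P); have [n0 /hasP[q hq oq]] := andP k1.
  have [p hp [n h]] := hostP P hP n0; have eqp := owner_unique hq hp oq n.
  have hd d : d \in heads p.1 -> d \in Hg.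
    move=> hd; apply/flattenP; exists (heads q.1); last by rewrite -eqp.
    apply/mapP; exists q => //; rewrite mem_filter hq andbT /nice.
    suff : P \in private Ps q by case: (private _ _).
    by rewrite mem_filter hP andbT.
  rewrite /= addn0.
  case: h => [/hd ->|[/hd -> _]] //; by rewrite addn1.
have e3 : count c0 Ps + count c1 Ps + count c2 Ps = size Ts + size Ts.
  have e P : c0 P + c1 P + c2 P = 1.
    by rewrite /c2 /c1; case: (c0 P) => //=; case: (has _ _).
  by rewrite -szP; elim: (Ps) => //= P r IH; have := e P; lia.
have e4 : count nice (picks Ts) + count (predC nice) (picks Ts) = size Ts.
  by rewrite count_predC -[in RHS](picks_fst Ts) size_map.
have le5 : count (fun p => ~~ served Ps p) (picks Ts) <= count (predC nice) (picks Ts).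
  apply: sub_count => p /=; rewrite /served negb_or /nice => /andP[_].
  by rewrite negbK.
rewrite /untouched size_filter -/c0.
have sum_count (c : seq dart -> bool) : \sum_(P <- Ps) c P = count c Ps.
  by rewrite -sum1_count [RHS]big_mkcond; apply: eq_bigr => P _; case: (c P).
move: le1 le2; rewrite big_split /= -big_distrr /= !sum_count => le1 le2.
(* The first and third relations give s <= a, so 2a >= a + s = 2k - f >= 2k - 2g = 2m. *)
have arith (n a f s g m k : nat) : f + 2 * s <= k + k -> f <= g + g ->
    a + f + s = k + k -> g + m = k -> n <= m -> n <= a by lia.
exact: (arith _ _ _ _ _ _ _ le1 le2 e3 e4 le5).
Qed.
End Counting.

(** * From closed trails to trails between the two terminals *)

Lemma wok_split x s z y : wok x s z -> y \in x :: [seq dst d | d <- s] ->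
  exists l r, [/\ s = l ++ r, wok x l y & wok y r z].
Proof.
elim: s x => [|d s IH] x.
  by rewrite inE => /= xz /eqP ->; exists [::], [::]; rewrite /= eqxx.
move=> ws; rewrite inE => /predU1P[->|]; first by exists [::], (d :: s); rewrite /= eqxx.
move: ws => /= /andP[xd ws] /(IH _ ws)[l [r [-> wl wr]]].
by exists (d :: l), r; rewrite /= xd wl.
Qed.

Lemma wok_mem x s z d : wok x s z -> d \in s ->
  src d \in x :: [seq dst d' | d' <- s] /\ dst d \in x :: [seq dst d' | d' <- s].
Proof.
elim: s x => //= c s IH x /andP[/eqP cx ws]; rewrite inE => /predU1P[->|ds].
  by rewrite cx !inE !eqxx !orbT.
by have [h1 h2] := IH _ ws ds; rewrite inE h1 orbT inE h2 orbT.
Qed.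

Lemma first_meeting (V : pred nat) x s z : wok x s z -> V z -> exists l r y,
  [/\ s = l ++ r, wok x l y, V y & forall d, d \in l -> ~~ V (src d)].
Proof.
elim: s x => [|d s IH] x /=.
  by move=> /eqP -> Vz; exists [::], [::], z; rewrite /= eqxx.
case/andP=> /eqP dx ws Vz; have [Vx|nVx] := boolP (V x).
  by exists [::], (d :: s), x; rewrite /= eqxx.
have [l [r [y [-> wl Vy h]]]] := IH _ ws Vz.
exists (d :: l), r, y; split=> //; first by rewrite /= dx eqxx.
by move=> c; rewrite inE => /predU1P[->|/h] //; rewrite dx.
Qed.

(* A closed odd trail at a splits, at the first vertex of it met by a path
   from b to a, into two sides of different parity. *)
Lemma odd_attachment E a b (T Q : seq dart) : {subset T <= darts E} ->
    wok a T a -> uniq (edges T) -> odd (size T) -> simple_path E b a Q ->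
  exists2 w, w \in splices T Q & [/\ wok b w a, uniq (edges w) & odd (size w)].
Proof.
move=> sT wT uT oT sQ; have [sQE wQ _] := sQ.
pose V y := y \in a :: [seq dst d | d <- T].
have [|A [B [y [eQ wA Vy nV]]]] := first_meeting (V := V) wQ.
  exact: mem_head.
have [L [R [eT wL wR]]] := wok_split wT Vy.
have uA : uniq (edges A).
  by have := simple_path_uniq sQ; rewrite eQ uniq_edges_cat => /and3P[].
(* Every dart of [A] leaves a vertex off [T], while an edge of [T] has both its ends on [T]. *)
have dAT : edisj A T.
  apply/edisjP=> _ /mapP[d dA ->]; apply/mapP=> -[d' d'T e].
  have dE : d \in darts E by apply: sQE; rewrite eQ mem_cat dA.
  have [h1 h2] := wok_mem wT d'T; move: (nV _ dA).
  by have [->|->] := same_edge dE (sT _ d'T) e; rewrite /V /= ?h1 ?h2.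
have [oddR|evenR] := boolP (odd (size (A ++ R))).
  exists (A ++ R).
    apply/mem_splices; exists (size A), (size L), T; rewrite mem_head.
    by rewrite eQ eT take_size_cat // drop_size_cat.
  split=> //; first by apply/wok_catP; exists y.
  move: uT; rewrite eT !uniq_edges_cat uA => /and3P[_ _ ->]; rewrite andbT.
  by apply: edisj_sub dAT => // e; rewrite eT edges_cat mem_cat orbC => ->.
exists (A ++ wrev L).
  apply/mem_splices; exists (size A), (size (wrev R)), (wrev T).
  rewrite mem_seq2 eqxx orbT eQ take_size_cat // eT /wrev map_cat rev_cat.
  by rewrite drop_size_cat.
split.
- by apply/wok_catP; exists y => //; apply: wok_wrev.
- rewrite uniq_edges_cat uA edges_wrev rev_uniq.
  move: uT; rewrite eT uniq_edges_cat => /andP[-> _]; rewrite andbT.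
  rewrite edisj_sym edisj_wrev edisj_sym; apply: edisj_sub dAT => // e.
  by rewrite eT edges_cat mem_cat => ->.
- move: oT evenR; rewrite eT !size_cat size_wrev !oddD.
  by case: (odd (size A)); case: (odd (size L)); case: (odd (size R)).
Qed.

Lemma splices_edges T Q w e : w \in splices T Q -> e \in edges w ->
  e \in edges T \/ e \in edges Q.
Proof.
move=> /mem_splices[i [j [T' [hT ->]]]]; rewrite edges_cat mem_cat.
case/orP=> /mapP[d + ->]; first by move/mem_take=> h; right; apply: map_f.
move/mem_drop=> h; left; have : d.1 \in edges T' by apply: map_f.
by move: hT; rewrite mem_seq2 => /pred2P[] ->; rewrite ?edges_wrevE.
Qed.

(** [convert] keeps whichever candidate comes first, so all candidates are shown to be good and one
    to exist: [T] itself, as a trivial splice, when it already joins the terminals; otherwise an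
    attachment along [P] for a trail closed at [u], along [wrev P] for one closed at [v]. *)
Lemma convertP E u v T P : u != v -> {subset T <= darts E} -> otrail u v T ->
    {subset P <= darts E} -> start T != finish T \/ simple_path E v u P ->
  [/\ {subset convert u v (T, P) <= darts E}, otrail u v (convert u v (T, P)),
      start (convert u v (T, P)) != finish (convert u v (T, P)) &
      forall e, e \in edges (convert u v (T, P)) -> e \in edges T \/ e \in edges P].
Proof.
move=> uv sT oT sP h; rewrite /convert -[(T, P).1]/T -[(T, P).2]/P; set C := filter _ _.
have good w : w \in C -> [/\ {subset w <= darts E}, otrail u v w,
    start w != finish w & forall e, e \in edges w -> e \in edges T \/ e \in edges P].
  rewrite mem_filter mem_cat => /andP[/andP[ow nw] /orP[hw|hw]].
    split=> //; last by move=> e he; apply: splices_edges hw he.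
    apply: (@splices_sub E [:: P] _ T P w _ sT hw); rewrite ?mem_head // => Q.
    by rewrite inE => /eqP ->.
  split=> //; last by move=> e he; have := splices_edges hw he; rewrite edges_wrevE.
  apply: (@splices_sub E [:: wrev P] _ T (wrev P) w _ sT hw);
    rewrite ?mem_head // => Q.
  by rewrite inE => /eqP -> d; rewrite mem_wrev -(drev_darts E) => /sP.
suff : exists w, w \in C.
  by case=> w; case: C good => // w' C good _; apply: good; apply: mem_head.
have [clT|] := eqVneq (start T) (finish T); last first.
  move=> nT; exists T; rewrite mem_filter oT nT mem_cat; apply/orP; left.
  by apply/mem_splices; exists 0, 0, T; rewrite mem_head take0 drop0.
case: h => [|sp]; first by rewrite clT eqxx.
have /otrailP[x [y [hx hy wT uT odT]]] := oT.
have nT : T != [::] by case: (T) odT.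
rewrite (wok_start nT wT) (wok_finish nT wT) in clT; rewrite -{y}clT in hy wT.
have fin b w Q : b \in [:: u; v] -> b != x -> w \in splices T Q ->
    wok b w x -> uniq (edges w) -> odd (size w) ->
    otrail u v w && (start w != finish w).
  move=> hb bx hw ww uw ow; have nw : w != [::] by case: (w) ow.
  rewrite (wok_start nw ww) (wok_finish nw ww) bx andbT.
  by apply/otrailP; exists b, x.
have : (x == u) || (x == v) by move: hx; rewrite mem_seq2.
case/orP=> /eqP ex; rewrite {}ex in hx wT fin.
  have [w hw [ww uw ow]] := odd_attachment sT wT uT odT sp.
  exists w; rewrite mem_filter mem_cat hw andbT.
  by apply: (fin v w P) => //; rewrite ?mem_seq2 ?eqxx ?orbT // eq_sym.
have [w hw [ww uw ow]] := odd_attachment sT wT uT odT (simple_path_wrev sp).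
exists w; rewrite mem_filter mem_cat hw orbT andbT.
by apply: (fin u w (wrev P)) => //; rewrite ?mem_seq2 ?eqxx.
Qed.

Lemma uniq_of_edges (Ts : seq (seq dart)) : (forall T, T \in Ts -> T != [::]) ->
  uniq (edges (flatten Ts)) -> uniq Ts.
Proof.
elim: Ts => //= T Ts IH nT; rewrite uniq_edges_cat edisj_flatten.
case/and3P=> _ /allP dT uT; rewrite IH // ?andbT; last first.
  by move=> S hS; apply: nT; rewrite inE hS orbT.
apply/negP=> /dT /edisjP h; have /head_in/(map_f fst) hT := nT T (mem_head _ _).
by have := h _ hT; rewrite hT.
Qed.

Lemma zip_inj (A B : eqType) (s : seq A) (t : seq B) x y z : uniq t ->
  (x, z) \in zip s t -> (y, z) \in zip s t -> x = y.
Proof.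
have zs (a : A) (b : B) s' t' : (a, b) \in zip s' t' -> b \in t'.
  elim: s' t' => [|a' s' IH] [|b' t'] //=; rewrite !inE xpair_eqE.
  by case/orP=> [/andP[_ ->]|/IH ->]; rewrite ?orbT.
elim: s t => [|a s IH] [|b t] //= /andP[nb ut]; rewrite !inE !xpair_eqE.
case/orP=> [/andP[/eqP -> /eqP ->]|h1] /orP[/andP[/eqP -> /eqP e]|h2] //.
- by rewrite (zs _ _ _ _ h2) in nb.
- by rewrite -e (zs _ _ _ _ h1) in nb.
- exact: IH h1 h2.
Qed.

Lemma mem_zip (A B : eqType) (s : seq A) (t : seq B) p :
  p \in zip s t -> p.1 \in s /\ p.2 \in t.
Proof.
elim: s t => [|a s IH] [|b t] //=; rewrite !inE.
by case/predU1P=> [->|/IH[-> ->]]; rewrite /= ?eqxx ?orbT.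
Qed.

Lemma pairwise_inj (A B : eqType) (f : A -> B) (r : rel A) s : uniq (map f s) ->
  (forall a b, a \in s -> b \in s -> f a != f b -> r a b) -> pairwise r s.
Proof.
elim: s => //= a s IH /andP[na us] h; rewrite IH ?andbT //; last first.
  by move=> b c hb hc; apply: h; rewrite inE ?hb ?hc orbT.
apply/allP=> b hb; apply: h; rewrite ?mem_head // ?inE ?hb ?orbT //.
by apply: contraNneq na => ->; apply: map_f.
Qed.

(** * Distribution of the paths among the trails *)

Section Assignment.
Variables (E : seq (nat * nat)) (u v : nat) (Ps Ts : seq (seq dart)).
Hypotheses (uv : u != v) (sp : forall P, P \in Ps -> simple_path E v u P).
Hypotheses (up : uniq (edges (flatten Ps))).
Hypothesis fT : fam E u v Ts.

Lemma Ps_uniq : uniq Ps.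
Proof.
apply: uniq_of_edges up => P /sp; apply: simple_path_nil.
by rewrite eq_sym.
Qed.

Lemma Ts_uniq : uniq Ts.
Proof.
have [_ oT uT] := fT; apply: uniq_of_edges uT => T /oT/and5P[_ _ odT _ _].
by case: T odT.
Qed.

(** [zip] truncates to the shorter list; the hypothesis guarantees that no unserved trail is lost in
    this way. *)
Lemma assignment_fst :
    count (fun p => ~~ served Ps p) (picks Ts) <= size (untouched Ps Ts) ->
  perm_eq (map fst (assignment Ps Ts)) Ts.
Proof.
move=> le; rewrite /assignment map_cat -map_comp -/(unzip1 _) unzip1_zip; last first.
  by rewrite size_map size_filter.
rewrite -[X in perm_eq (X ++ _)]/[seq p.1 | p <- picks Ts & served Ps p] -map_cat.
rewrite -[X in perm_eq _ X]picks_fst; apply: perm_map.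
by rewrite perm_filterC.
Qed.

Lemma assignmentP a : a \in assignment Ps Ts -> a.1 \in Ts /\
  [\/ a.2 = [::] /\ start a.1 != finish a.1,
      exists p, [/\ p \in picks Ts, a.1 = p.1, a.2 \in Ps & owner a.2 p] |
      [/\ a.2 \in Ps, all (edisj a.2) Ts &
       a \in zip [seq p.1 | p <- picks Ts & ~~ served Ps p] (untouched Ps Ts)]].
Proof.
have inT p : p \in picks Ts -> p.1 \in Ts.
  by move=> hp; rewrite -[X in _ \in X]picks_fst map_f.
rewrite mem_cat => /orP[/mapP[p]|ha].
  rewrite mem_filter => /andP[sv hp] ->; split; first exact: inT.
  move: sv; rewrite /served; case eP: (private Ps p) => [|P r].
    by rewrite orbF => nT; constructor 1.
  have : P \in private Ps p by rewrite eP mem_head.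
  rewrite mem_filter => /andP[oP hP] _; constructor 2.
  by exists p.
have [h1 h2] := mem_zip ha; split.
  by case/mapP: h1 => p; rewrite mem_filter => /andP[_ /inT hp] ->.
by constructor 3; move: h2; rewrite mem_filter => /andP[].
Qed.

Lemma fam_disj T T' : T \in Ts -> T' \in Ts -> T != T' -> edisj T T'.
Proof.
have [_ _ uT] := fT; move=> hT hT' /eqP ne; apply/edisjP=> e eT; apply/negP=> eT'.
exact/ne/(flatten_edge_inj uT hT hT' eT eT').
Qed.

Lemma edisj_nil s : edisj [::] s.
Proof. by []. Qed.

(** Each trail with its path forms a territory that [convert] does not leave, so disjoint
    territories make the converted trails disjoint. *)
Lemma assignment_disj a b : a \in assignment Ps Ts -> b \in assignment Ps Ts ->
  a.1 != b.1 -> edisj (a.1 ++ a.2) (b.1 ++ b.2).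
Proof.
have cross c d : c \in assignment Ps Ts -> d \in assignment Ps Ts ->
    c.1 != d.1 -> edisj c.2 d.1.
  move=> /assignmentP[_ hc] /assignmentP[hd _] ne.
  case: hc => [[-> _]|[p [hp ec _ /andP[_ /allP h]]]|[_ /allP h _]].
  - exact: edisj_nil.
  - by apply: h; have [ed|//] := picks_others hp hd; rewrite ec ed eqxx in ne.
  - exact: h.
move=> ha hb ne; have hab := cross _ _ ha hb ne.
have hba : edisj a.1 b.2 by rewrite edisj_sym; apply: cross; rewrite // eq_sym.
have [aT ka] := assignmentP ha; have [bT kb] := assignmentP hb.
have h1 := fam_disj aT bT ne.
suff h2 : edisj a.2 b.2.
  apply/edisjP=> e; rewrite !edges_cat !mem_cat negb_or.
  by case/orP=> he; rewrite !(edisjP _ _ _ _ he).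
have disjP : a.2 \in Ps -> b.2 \in Ps -> a.2 != b.2 -> edisj a.2 b.2.
  move=> hP hP' /eqP n; apply/edisjP=> e eP; apply/negP=> eP'.
  exact/n/(flatten_edge_inj up hP hP' eP eP').
(* Two trails never share a nonempty path: a private path has a single owner, an untouched path is
   private to no trail, and [zip] uses each untouched path once. *)
have [eab|nab] := eqVneq a.2 b.2; last first.
  have ka' : a.2 = [::] \/ a.2 \in Ps.
    by case: ka => [[h _]|[p [_ _ h _]]|[h _ _]]; auto.
  have kb' : b.2 = [::] \/ b.2 \in Ps.
    by case: kb => [[h _]|[p [_ _ h _]]|[h _ _]]; auto.
  case: ka' => [->|hA]; first exact: edisj_nil.
  by case: kb' => [->|hB]; [rewrite edisj_sym edisj_nil | apply: disjP].
case: ka => [[-> _]|[p [hp ea h /andP[np /allP op]]]|[h /allP oa za]].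
- exact: edisj_nil.
- case: kb => [[-> _]|[q [hq eb _ oq]]|[_ /allP ob _]].
  + by rewrite edisj_sym edisj_nil.
  + by move: ne; rewrite ea eb (owner_unique hq hp oq) ?eqxx // -eab.
  + by case/negP: np; rewrite eab ob // -ea.
- case: kb => [[-> _]|[q [hq eb _ /andP[nq _]]]|[_ _ zb]].
  + by rewrite edisj_sym edisj_nil.
  + by case/negP: nq; rewrite -eab oa // -eb.
  + have uZ : uniq (untouched Ps Ts) by apply: filter_uniq Ps_uniq.
    move: za zb ne; case: (a) (b) eab => [T P] [T' P'] /= -> za zb.
    by rewrite (zip_inj uZ za zb) eqxx.
Qed.

End Assignment.

Lemma packP E (u v : nat) Ts : u != v -> fam E u v Ts ->
    (forall X : pred nat, X v -> ~~ X u ->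
       size Ts + size Ts <= count (crossing X) E) ->
  exists ws, [/\ pack E u v Ts = map (walk_of u) ws, size ws = size Ts,
    forall w, w \in ws ->
      [/\ {subset w <= darts E}, otrail u v w & start w != finish w] &
    pairwise edisj ws].
Proof.
move=> uv fT cut; rewrite /pack; set Ps := disjoint_paths _ _ _ _.
have vu : v != u by rewrite eq_sym.
have [szP up sp] := disjoint_pathsP vu cut; rewrite -/Ps in szP up sp.
have QE Q : Q \in Ps ++ map wrev Ps -> {subset Q <= darts E} by apply: (Qs_sub sp).
have [fT' szT stuck] := reduceP QE fT; set Ts' := reduce _ _ _ _ in fT' szT stuck *.
rewrite -szT in szP.
have le := few_unserved uv sp up szP fT' stuck.
have eL := assignment_fst le.
have uT' := Ts_uniq fT'; have [sT oT _] := fT'.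
pose L := assignment Ps Ts'.
have conv a : a \in L -> [/\ {subset convert u v a <= darts E},
    otrail u v (convert u v a), start (convert u v a) != finish (convert u v a) &
    forall e, e \in edges (convert u v a) -> e \in edges a.1 \/ e \in edges a.2].
  move=> /assignmentP[hT ha]; case: a hT ha => T P /= hT ha.
  have hP : {subset P <= darts E} /\ (start T != finish T \/ simple_path E v u P).
    case: ha => [[-> h]|[p [_ _ /sp h _]]|[/sp h _ _]]; last 2 first.
    - by have [sE _ _] := h; split=> //; right.
    - by have [sE _ _] := h; split=> //; right.
    - by split=> //; left.
  by case: hP => sP h; apply: convertP => //; [apply: sT | apply: oT].
exists (map (convert u v) L); split.
- by rewrite -map_comp.
- by rewrite size_map -szT -(perm_size eL) size_map.
- by move=> _ /mapP[a /conv[h1 h2 h3 _] ->].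
rewrite pairwise_map; apply: (pairwise_inj (f := fst)).
  by rewrite (perm_uniq eL).
move=> a b ha hb ne.
have terr c : c \in L -> {subset edges (convert u v c) <= edges (c.1 ++ c.2)}.
  move=> /conv[_ _ _ h] e /h; rewrite edges_cat mem_cat.
  by case=> ->; rewrite ?orbT.
by apply: edisj_sub (assignment_disj uv sp up fT' ha hb ne); apply: terr.
Qed.

(** * Coding of graphs and walks *)

Lemma enc_map A B (eB : encodable B) (f : A -> B) (s : seq A) :
  enc (map f s) = enc_seq (fun x => enc (f x)) s.
Proof. by elim: s => //= a s <-. Qed.

Section Coding.
Variable G : mgraph.

Definition rank (T : finType) (x : T) : nat := enum_rank x.

Lemma rank_inj (T : finType) : injective (@rank T).
Proof. by move=> x y /val_inj/enum_rank_inj. Qed.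

Definition code_pair (T1 T2 : finType) (p : T1 * T2) : nat * nat :=
  (rank p.1, rank p.2).

Definition code_edges : seq (nat * nat) :=
  [seq code_pair (ends e) | e <- enum (edge G)].

Definition code_walk (w : walk G) : nat * seq (nat * nat) :=
  (rank w.1, [seq code_pair s | s <- w.2]).

(** The prescribed encoding of an instance is the generic encoding of purely numerical data, on
    which [solve] operates. *)
Lemma enc_instanceE (u v : vertex G) ws : enc_instance u v ws =
  enc ((#|vertex G|, code_edges), ((rank u, rank v), [seq code_walk w | w <- ws])).
Proof.
rewrite /enc_instance /enc /encodable_prod /=; congr Node.
  congr Node; rewrite -[RHS]/(enc code_edges) enc_map.
  by elim: (enum _) => //= e s ->.
congr Node; rewrite -[RHS]/(enc (map code_walk ws)) enc_map /enc_walks.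
elim: ws => //= w ws ->; congr Node; rewrite /enc /encodable_prod /enc_walk /=.
by congr Node; rewrite -[RHS]/(enc (map _ _)) enc_map; elim: (w.2) => //= e s ->.
Qed.

Lemma enc_walksE (ws : seq (walk G)) : enc_walks ws = enc [seq code_walk w | w <- ws].
Proof.
rewrite enc_map /enc_walks; elim: ws => //= w ws ->; congr Node.
rewrite /enc /encodable_prod /enc_walk /=.
by congr Node; rewrite -[RHS]/(enc (map _ _)) enc_map; elim: (w.2) => //= e s ->.
Qed.

Lemma size_code_edges : size code_edges = #|edge G|.
Proof. by rewrite size_map cardE. Qed.

Lemma nth_code_edges (e : edge G) : nth (0, 0) code_edges (rank e) = code_pair (ends e).
Proof.
by rewrite (nth_map e) -?cardE ?ltn_ord // nth_enum_rank.
Qed.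

Lemma joins_dart (e : edge G) x y :
  joins e x y = ((rank e, (rank x, rank y)) \in darts code_edges).
Proof.
rewrite mem_darts size_code_edges ltn_ord nth_code_edges /joins /code_pair /=.
case: (ends e) => a b; rewrite !xpair_eqE /=.
by rewrite !(inj_eq (@rank_inj _)).
Qed.

Fixpoint walk_darts (x : vertex G) (s : seq (edge G * vertex G)) : seq dart :=
  if s is (e, y) :: s' then (rank e, (rank x, rank y)) :: walk_darts y s' else [::].

Lemma darts_of_code (w : walk G) : darts_of (code_walk w) = walk_darts w.1 w.2.
Proof.
case: w => x s; rewrite /darts_of /code_walk /=.
have h acc : (foldl (fun (st : nat * seq dart) (a : nat * nat) =>
      (a.2, (a.1, (st.1, a.2)) :: st.2)) (rank x, acc) [seq code_pair p | p <- s]).2 =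
    catrev (walk_darts x s) acc.
  elim: s x acc => //= -[e y] s IH x acc; exact: IH.
by rewrite h catrevE cats0 revK.
Qed.

Lemma edges_walk_darts x s : edges (walk_darts x s) = [seq rank e | e <- unzip1 s].
Proof. by elim: s x => //= -[e y] s IH x /=; rewrite IH. Qed.

Lemma walk_darts_wok x s : wok (rank x) (walk_darts x s) (rank (last x (unzip2 s))).
Proof. by elim: s x => //= -[e y] s IH x /=; rewrite eqxx IH. Qed.

Lemma walk_darts_sub x s : steps_ok x s -> {subset walk_darts x s <= darts code_edges}.
Proof.
elim: s x => //= -[e y] s IH x /andP[h /IH hs] d.
by rewrite inE => /predU1P[->|/hs //]; rewrite -joins_dart.
Qed.

Lemma dart_edge (d : dart) (x : vertex G) :
    d \in darts code_edges -> src d = rank x ->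
  exists (e : edge G) (y : vertex G), joins e x y /\ d = (rank e, (rank x, rank y)).
Proof.
move=> dE sd; have := dE; rewrite mem_darts size_code_edges => /andP[lt _].
pose e : edge G := enum_val (Ordinal lt).
have re : d.1 = rank e by rewrite /rank /e enum_valK.
suff [y ey] : exists y : vertex G, dst d = rank y.
  exists e, y; rewrite joins_dart -re -sd -ey; move: dE; case: (d) => a [b c] //=.
move: dE; rewrite mem_darts re nth_code_edges => /andP[_ /orP[]]; rewrite /code_pair.
  by case: (d) => a [b c] /= /eqP[_ <-]; exists (ends e).2.
by move=> /eqP[<- _]; exists (ends e).1.
Qed.

Lemma decode_walk (x : vertex G) s (y : vertex G) :
    {subset s <= darts code_edges} -> wok (rank x) s (rank y) ->
  exists S : seq (edge G * vertex G),
    [/\ [seq code_pair p | p <- S] = [seq (d.1, dst d) | d <- s],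
    steps_ok x S & last x (unzip2 S) = y].
Proof.
elim: s x => [|d s IH] x sE /=; first by move/eqP/rank_inj => ->; exists [::].
case/andP=> /eqP sd ws; have [e [z [jz eqd]]] := dart_edge (sE d (mem_head _ _)) sd.
rewrite eqd /= in ws.
have [|S [eS okS lS]] := IH z _ ws.
  by move=> c cs; apply: sE; rewrite inE cs orbT.
by exists ((e, z) :: S); rewrite /= eS eqd jz okS lS.
Qed.

(** Minimality is applied to the complement of [X], since [lambda] ranges over the sides that
    contain [u] while a side for flows from [v] contains [v]. *)
Lemma lambda_cut (u v : vertex G) (X : pred nat) :
  u != v -> X (rank v) -> ~~ X (rank u) ->
  lambda u v <= count (crossing X) code_edges.
Proof.
move=> uv Xv Xu; rewrite /lambda; case: arg_minnP => [|S _ min].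
  by rewrite !inE eqxx eq_sym uv.
pose C := [set x : vertex G | ~~ X (rank x)].
have := min C; rewrite !inE Xu negbK Xv => /(_ isT)/leq_trans; apply.
rewrite count_map enumT cardE /enum_mem size_filter; apply: eq_leq.
apply: eq_count => e /=; rewrite !inE /crossing /=.
by case: (X _); case: (X _).
Qed.

(** Inclusion of the edges is all that is needed to carry disjointness from dart lists over to
    walks. *)
Definition codes (w : seq dart) (W : walk G) :=
  {subset [seq rank e | e <- walk_edges W] <= edges w}.

Lemma decode_trails (u v : vertex G) (ws : seq (seq dart)) : u != v ->
    (forall w, w \in ws -> [/\ {subset w <= darts code_edges},
       otrail (rank u) (rank v) w & start w != finish w]) ->
    pairwise edisj ws ->
  exists Ws : seq (walk G), [/\
    [seq code_walk W | W <- Ws] = [seq walk_of (rank u) w | w <- ws],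
    forall W, W \in Ws -> [/\ is_trail u v W, odd (walk_length W) &
      exists2 w, w \in ws & codes w W] &
    pairwise (@edge_disjoint G) Ws].
Proof.
move=> uv; elim: ws => [|w ws IH] hw; first by exists [::].
rewrite pairwise_cons => /andP[dw /IH[|Ws [eW hW pW]]].
  by move=> w' h; apply: hw; rewrite inE h orbT.
have [sw ow nw] := hw w (mem_head _ _).
(* The orientation chosen by [walk_of]: as the ends of [w] are distinct, [w'] leads from [u] to
   [v]. *)
set w' := if start w == rank u then w else wrev w.
have ew' : edges w' =i edges w by rewrite /w'; case: ifP => // _; apply: edges_wrevE.
have sw' : {subset w' <= darts code_edges}.
  rewrite /w'; case: ifP => // _ d; rewrite mem_wrev -(drev_darts code_edges); exact: sw.
have [ww' uw' ow'] : [/\ wok (rank u) w' (rank v), uniq (edges w') & odd (size w')].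
  have /otrailP[a [b [ha hb ww uw odw]]] := ow.
  have nilw : w != [::] by case: (w) odw.
  move: nw; rewrite /w' (wok_start nilw ww) (wok_finish nilw ww).
  move: ha hb; rewrite !mem_seq2; have ruv : rank v == rank u = false.
    by rewrite (inj_eq (@rank_inj _)) eq_sym (negbTE uv).
  case/pred2P=> ea; case/pred2P=> eb; rewrite ea eb ?eqxx // => _; rewrite ea eb in ww.
    by [].
  rewrite ruv edges_wrev rev_uniq size_wrev; split=> //; exact: wok_wrev.
have [S [eS okS lS]] := decode_walk sw' ww'.
have edS : [seq rank e | e <- unzip1 S] = edges w'.
  have -> : [seq rank e | e <- unzip1 S] = map fst [seq code_pair p | p <- S].
    by rewrite /unzip1 -!map_comp.
  by rewrite eS -map_comp.
have szS : size S = size w' by rewrite -(size_map (fun p => code_pair p)) eS size_map.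
have cW : codes w (u, S) by move=> e; rewrite /walk_edges /= edS ew'.
exists ((u, S) :: Ws); split=> [|W|].
- by rewrite /= eW /code_walk /= eS.
- rewrite inE => /predU1P[->|/hW[h1 h2 [w2 h3 h4]]]; last first.
    by split=> //; exists w2; rewrite // inE h3 orbT.
  split; last by exists w; rewrite ?mem_head.
    rewrite /is_trail /is_walk /= eqxx lS eqxx okS /=.
    by rewrite -(map_inj_uniq (@rank_inj _)) edS.
  by rewrite /walk_length size_map szS.
- rewrite /= pW andbT; apply/allP=> W /hW[_ _ [w2 h3 h4]].
  rewrite /edge_disjoint disjoint_has; apply/hasPn=> e eW'; apply/negP=> eW2.
  have /cW h : rank e \in [seq rank e | e <- walk_edges (u, S)] by apply: map_f.
  have /h4 h' : rank e \in [seq rank e | e <- walk_edges W] by apply: map_f.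
  by have := edisjP _ _ (allP dw _ h3) _ h; rewrite h'.
Qed.

Lemma code_fam (u v : vertex G) (That : seq (walk G)) :
    (forall T, T \in That ->
       is_set_trail [set u; v] [set u; v] T /\ odd (walk_length T)) ->
    pairwise (@edge_disjoint G) That ->
  fam code_edges (rank u) (rank v) [seq darts_of (code_walk T) | T <- That].
Proof.
move=> hT pT; have hT' T : T \in That -> exists p q, [/\ p \in [set u; v],
    q \in [set u; v], is_trail p q T & odd (walk_length T)].
  move=> /hT[/existsP[p /andP[hp /existsP[q /andP[hq h]]]] od].
  by exists p, q.
split=> [_ /mapP[T /hT'[p [q [hp hq /andP[/and3P[_ _ ok] un] od]]] ->]||].
- by rewrite darts_of_code; apply: walk_darts_sub.
- move=> _ /mapP[T /hT'[p [q [hp hq /andP[/and3P[/eqP ep /eqP eq ok] un] od]]] ->].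
  rewrite darts_of_code; apply/otrailP; exists (rank p), (rank q).
  have mr x : x \in [set u; v] -> rank x \in [:: rank u; rank v].
    by rewrite !inE => /orP[] /eqP->; rewrite eqxx ?orbT.
  split; rewrite ?mr //.
  + by rewrite -ep -eq; apply: walk_darts_wok.
  + by rewrite edges_walk_darts (map_inj_uniq (@rank_inj _)).
  + by rewrite -(size_map fst) -/(edges _) edges_walk_darts size_map.
- elim: That hT' pT {hT} => // T That IH hT' /andP[dT pT].
  rewrite /= uniq_edges_cat edisj_flatten IH //; last first.
    by move=> S hS; apply: hT'; rewrite inE hS orbT.
  have [p [q [_ _ /andP[_ un] _]]] := hT' T (mem_head _ _).
  rewrite darts_of_code edges_walk_darts (map_inj_uniq (@rank_inj _)) un andbT /=.
  apply/allP=> _ /mapP[S hS ->]; apply/edisjP=> e.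
  rewrite !darts_of_code !edges_walk_darts.
  move=> /mapP[g gT ->]; rewrite (mem_map (@rank_inj _)).
  have dTS : edge_disjoint T S := allP dT _ hS.
  by rewrite -/(walk_edges S) (disjointFr dTS gT).
Qed.

End Coding.

Theorem theorem3p3 :
  exists (P : prog) (c d : nat),
    forall (G : mgraph) (u v : vertex G) (That : seq (walk G)),
      u != v ->
      (forall T, T \in That ->
         is_set_trail [set u; v] [set u; v] T /\ odd (walk_length T)) ->
      pairwise (@edge_disjoint G) That ->
      2 * size That <= lambda u v ->
      exists (Ts : seq (walk G)) (t : nat),
        [/\ run P (enc_instance u v That) (enc_walks Ts) t,
            t <= c * tree_size (enc_instance u v That) ^ d,
            size Ts = size That,
            (forall T, T \in Ts -> is_trail u v T /\ odd (walk_length T)) &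
            pairwise (@edge_disjoint G) Ts].
Proof.
(* The program and the polynomial are fixed before the graph: [solve] is one function on numerical
   data, and the graph enters only through its encoding. *)
have [P [q [[c [d hq]] hP]]] := polytime_solve.
exists P, c, d => G u v That uv hT pT lam.
have fT := code_fam hT pT.
have ruv : rank u != rank v by rewrite (inj_eq (@rank_inj _)).
have [|ws [es sz hw pw]] := packP ruv fT.
  move=> X Xv Xu; rewrite size_map addnn -mul2n.
  exact: leq_trans lam (lambda_cut uv Xv Xu).
have [Ws [eW hW pW]] := decode_trails uv hw pw.
rewrite enc_instanceE; set I := (_, _).
have [t rt lt] := hP I; exists Ws, t; split=> //.
- by rewrite enc_walksE eW -es; move: rt; rewrite /solve /= -map_comp.
- exact: leq_trans lt (hq I).
- by rewrite -(size_map (@code_walk G)) eW size_map sz size_map.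
- by move=> T /hW[].
Qed.
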